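(* Let $\mathbb{F}$ be a field of characteristic $2$ with $q$ elements ($q$ finite), and let $b\in\mathbb{F}\setminus\{x^2+x\mid x\in\mathbb{F}\}$. Let $\widetilde{D}=M_2(\mathbb{F})$ with the $\mathbb{Z}_2$-grading $$\widetilde{D}_0=\left\{\begin{pmatrix}u&u+v\\ b(u+v)&v\end{pmatrix}\;\middle|\;u,v\in\mathbb{F}\right\},\qquad \widetilde{D}_1=\left\{\begin{pmatrix}bu+v&u\\ v&bu+v\end{pmatrix}\;\middle|\;u,v\in\mathbb{F}\right\}.$$ Then the ideal of $\mathbb{Z}_2$-graded polynomial identities of $\widetilde{D}$ is generated, as a $T_{\mathbb{Z}_2}$-ideal, by the polynomials $$f_1=y_1^{q^2}-y_1,\qquad f_2=z_1^{2q^2-1}-z_1,\qquad f_3=z_1y_1-y_1^{q}z_1,$$ $$f_4=(X_1-X_1^{q})(X_2-X_2^{q^2})(1-[X_1,X_2]^{q-1}),\quad X_i=z_i+y_i\ (i=1,2),$$ where $y_i$ are indeterminates of degree $0$ and $z_i$ are indeterminates of degree $1$.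
   Context: Algebras are associative and not necessarily unital. For a group $G$, a $G$-graded $\mathbb{F}$-algebra is an algebra $A=\bigoplus_{g\in G}A_g$ (direct sum of subspaces) with $A_gA_h\subseteq A_{gh}$. $\mathbb{F}\langle X_G\rangle$ is the free $G$-graded associative algebra (without unit) on the disjoint union of the countable sets $X_g=\{x_{i,g}\mid i\ge 1\}$, $g\in G$, where $x_{i,g}$ has degree $g$. A polynomial $f(x_{1,g_1},\dots,x_{n,g_n})$ is a graded polynomial identity of $A$ if $f(a_1,\dots,a_n)=0$ for all $a_i\in A_{g_i}$. The set $Id_G(A)$ of graded identities of $A$ is a $T_G$-ideal, i.e. a two-sided ideal invariant under all graded endomorphisms of $\mathbb{F}\langle X_G\rangle$. The $T_G$-ideal generated by a set $S$ is the smallest $T_G$-ideal containing $S$. Here $G=\mathbb{Z}_2$, $y_i=x_{i,0}$, $z_i=x_{i,1}$, and $[a,b]=ab-ba$. The expression $u(1-v)$ means $u-uv$. *)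

(* Defs.v *)
From HB Require Import structures.
From mathcomp Require Import all_boot all_order all_algebra finmap.
From mathcomp.multinomials Require Import monalg.

Set Implicit Arguments.
Unset Strict Implicit.
Unset Printing Implicit Defensive.

Import GRing.Theory.
Local Open Scope ring_scope.

(* The variable (i, g) is x_(i+1,g); its degree is g.  The group is written   *)
(* additively, so that the degree of a word is the sum of the degrees of its  *)
(* letters.                                                                   *)
Definition gvar (G : zmodType) : choiceType := (nat * G)%type.

(* The unital free algebra on the graded variables.  The free algebra without *)
(* unit is its subspace nonunital; homog g is the component of degree g of    *)
(* the latter.  Working inside the unital algebra gives a meaning to powers   *)
(* and to factors such as 1 - v.                                              *)
Notation freealg F G := {malg F[{fmonom (gvar G)}]}.

Section FreeGradedAlgebra.
Variables (F : fieldType) (G : zmodType).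
Implicit Types (f : freealg F G) (g : G) (w : {fmonom (gvar G)}).

Definition gX (i : nat) (g : G) : freealg F G :=
  << fmu ((i, g) : gvar G) >>.

Definition wdeg w : G := \sum_(x <- (w : seq (gvar G))) x.2.

Definition nonunital : {pred freealg F G} := [pred f | f@_mone == 0].

Definition homog g : {pred freealg F G} :=
  [pred f | (f \in nonunital) && all (fun w => wdeg w == g) (msupp f)].

(* Only the values of phi on nonunital are constrained: its restriction is an *)
(* endomorphism of the non-unital algebra preserving the grading.             *)
Record graded_endo (phi : freealg F G -> freealg F G) : Prop := GradedEndo {
  graded_endo_linear : forall (c : F) f1 f2,
    f1 \in nonunital -> f2 \in nonunital ->
    phi (c *: f1 + f2) = c *: phi f1 + phi f2;
  graded_endoM : forall f1 f2,
    f1 \in nonunital -> f2 \in nonunital -> phi (f1 * f2) = phi f1 * phi f2;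
  graded_endo_homog : forall g f, f \in homog g -> phi f \in homog g
}.

Record T_ideal (I : freealg F G -> Prop) : Prop := TIdeal {
  T_ideal_nonunital : forall f, I f -> f \in nonunital;
  T_ideal0 : I 0;
  T_ideal_linear : forall (c : F) f1 f2, I f1 -> I f2 -> I (c *: f1 + f2);
  T_idealMl : forall f1 f2, f1 \in nonunital -> I f2 -> I (f1 * f2);
  T_idealMr : forall f1 f2, I f1 -> f2 \in nonunital -> I (f1 * f2);
  T_ideal_endo : forall phi f, graded_endo phi -> I f -> I (phi f)
}.

Definition T_ideal_gen (S : freealg F G -> Prop) f : Prop :=
  forall I, T_ideal I -> (forall s, S s -> I s) -> I f.

Variable A : algType F.

Definition geval (a : gvar G -> A) f : A :=
  mmap (in_alg A) (fun w => \prod_(x <- (w : seq (gvar G))) a x) f.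

Definition graded_identity (D : G -> {pred A}) f : Prop :=
  f \in nonunital /\
  forall a : gvar G -> A, (forall x, a x \in D x.2) -> geval a f = 0.

End FreeGradedAlgebra.

Definition comm (R : pzRingType) (u v : R) : R := u * v - v * u.

Definition mx2 (R : Type) (a b c d : R) : 'M[R]_2 :=
  \matrix_(i < 2, j < 2)
    if i == 0 then (if j == 0 then a else b) else (if j == 0 then c else d).

Definition Dtilde (F : finFieldType) (b : F) (g : 'Z_2) : {pred 'M[F]_2} :=
  if g == 0 then
    [pred M | [exists u, exists v, M == mx2 u (u + v) (b * (u + v)) v]]
  else
    [pred M | [exists u, exists v, M == mx2 (b * u + v) u v (b * u + v)]].

Section TheGenerators.
Variable F : finFieldType.
Let P := freealg F 'Z_2.

Definition yvar (i : nat) : P := gX F i 0.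
Definition zvar (i : nat) : P := gX F i 1.
Definition Xvar (i : nat) : P := zvar i + yvar i.

Definition gen1 (q : nat) : P := yvar 0 ^+ (q ^ 2) - yvar 0.
Definition gen2 (q : nat) : P := zvar 0 ^+ (2 * q ^ 2 - 1) - zvar 0.
Definition gen3 (q : nat) : P := zvar 0 * yvar 0 - yvar 0 ^+ q * zvar 0.
Definition gen4 (q : nat) : P :=
  (Xvar 0 - Xvar 0 ^+ q) * (Xvar 1 - Xvar 1 ^+ (q ^ 2)) *
    (1 - comm (Xvar 0) (Xvar 1) ^+ (q - 1)).

End TheGenerators.

(* Main.v *)
(* Write q^2 = Q.  The identity f4 turns out to follow from f1, f2 and f3.

   Let I be a T-ideal containing the generators and f an element outside I.
   By Zorn's lemma there is a two-sided ideal J of the unital free algebra that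
   contains I and is maximal among those avoiding f.  In the quotient R by J,
   let S be the image of the elements of even degree (and of the constants) and
   T that of the odd ones.  An idempotent e of S commutes with T because
   z e = e^q z, and with S because S is reduced; so it is central, and
   maximality of J forces e = 0 or e = 1.  As y^Q = y on S, every non-zero y in S
   satisfies y^(Q-1) = 1, and S is commutative by Jacobson's theorem.

   Hence S is F, or F[t] with t^2 = t + b: an Artin-Schreier generator exists,
   and b may be taken as its constant because the x^2 + x form a subgroup of
   index 2.  A non-zero z in T has z^2 in F, which rescales to j with j^2 = 1,
   and then T = S j.  The algebra of the grading of M_2(F) has the same
   presentation with both t and j present, so the graph of the partial map
   sending its basis 1, t, j, tj to the elements available in R is
   multiplicative.  Lifting the images of the variables along this graph, an
   identity of M_2(F) vanishes in R; since f does not, it is not an identity. *)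
Require Import Defs.
From HB Require Import structures.
From mathcomp Require Import all_boot all_order all_algebra finfield finmap.
From mathcomp.multinomials Require Import monalg.
From mathcomp Require Import generic_quotient ring_quotient boolp.
From mathcomp Require classical_sets.
From mathcomp Require Import zify ring.
Import GRing.Theory.
Local Open Scope ring_scope.
Set Implicit Arguments.
Unset Strict Implicit.
Unset Printing Implicit Defensive.

(** * Quotient of an algebra by a proper two-sided ideal *)

Record two_sided (A : nzRingType) (J : A -> Prop) : Prop := TwoSided {
  two_sided0 : J 0;
  two_sidedB : forall x y, J x -> J y -> J (x - y);
  two_sidedMl : forall x y, J y -> J (x * y);
  two_sidedMr : forall x y, J x -> J (x * y)
}.

Section QuotientAlgebra.
Local Open Scope quotient_scope.
Variables (F : fieldType) (A : lalgType F).
(** As an [lalgType], [A] only lets scalars pass on the left; the right-hand rule makes the quotient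
    an [algType]. *)
Hypothesis scaleAr : forall (c : F) (x y : A), c *: (x * y) = x * (c *: y).
Variables (J : A -> Prop) (idJ : two_sided J) (J1 : ~ J 1).

Definition idealp : {pred A} := fun x => `[< J x >].

Lemma idealpP x : reflect (J x) (x \in idealp).
Proof. exact: asboolP. Qed.

Lemma idealp_zmod_closed : zmod_closed idealp.
Proof.
split; first exact/idealpP/(two_sided0 idJ).
by move=> x y /idealpP Jx /idealpP Jy; apply/idealpP/(two_sidedB idJ).
Qed.

HB.instance Definition _ := GRing.isZmodClosed.Build A idealp idealp_zmod_closed.

Definition quotient_type := Quotient.quot idealp.
HB.instance Definition _ := GRing.Zmodule.on quotient_type.
Local Notation Q := quotient_type.
Let p (x : A) : Q := \pi_(Quotient.quot idealp) x.

Let p_eq x y : (p x = p y) <-> J (x - y).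
Proof.
split => [/eqP|Jxy]; first by rewrite /p -Quotient.idealrBE => /idealpP.
by apply/eqP; rewrite /p -Quotient.idealrBE; apply/idealpP.
Qed.

Let pK (u : Q) : p (repr u) = u.
Proof. exact: reprK. Qed.

Let pD x y : p (x + y) = p x + p y.
Proof. exact: pi_addr. Qed.

Let mulq (u v : Q) : Q := p (repr u * repr v).
Let scaleq (c : F) (u : Q) : Q := p (c *: repr u).

Let pM x y : p (x * y) = mulq (p x) (p y).
Proof.
apply/p_eq; set x' := repr (p x); set y' := repr (p y).
have Jx : J (x - x') by apply/p_eq; rewrite pK.
have Jy : J (y - y') by apply/p_eq; rewrite pK.
have -> : x * y - x' * y' = (x - x') * y - x' * (y' - y).
  by rewrite mulrBl mulrBr opprB addrA addrNK.
apply: (two_sidedB idJ); first exact: (two_sidedMr idJ).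
apply: (two_sidedMl idJ); rewrite -opprB -sub0r.
by apply: (two_sidedB idJ) => //; apply: (two_sided0 idJ).
Qed.

(** [J] is only a ring ideal; writing a scalar as the element [c%:A] shows that it is a subspace as
    well. *)
Let scale_mul (c : F) (x : A) : c *: x = c%:A * x.
Proof. by rewrite -scalerAl mul1r. Qed.

Let pZ c x : p (c *: x) = scaleq c (p x).
Proof.
apply/p_eq; rewrite -scalerBr scale_mul; apply: (two_sidedMl idJ).
by apply/p_eq; rewrite pK.
Qed.

Let mulqA : associative mulq.
Proof.
by move=> u v w; rewrite -[u]pK -[v]pK -[w]pK -!pM mulrA.
Qed.
Let mul1q : left_id (p 1) mulq.
Proof. by move=> u; rewrite -[u]pK -pM mul1r. Qed.
Let mulq1 : right_id (p 1) mulq.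
Proof. by move=> u; rewrite -[u]pK -pM mulr1. Qed.
Let mulqDl : left_distributive mulq +%R.
Proof. by move=> u v w; rewrite -[u]pK -[v]pK -[w]pK -pD -!pM mulrDl pD. Qed.
Let mulqDr : right_distributive mulq +%R.
Proof. by move=> u v w; rewrite -[u]pK -[v]pK -[w]pK -pD -!pM mulrDr pD. Qed.
Let oneq_neq0 : p 1 != 0.
Proof.
apply/eqP => p10; apply: J1; rewrite -[1]subr0; apply/p_eq.
by rewrite p10; apply/esym/pi_zeror.
Qed.

HB.instance Definition _ := GRing.Zmodule_isNzRing.Build Q
  mulqA mul1q mulq1 mulqDl mulqDr oneq_neq0.

Let pMr x y : p (x * y) = p x * p y.
Proof. exact: pM. Qed.

Let scaleqA c d u : scaleq c (scaleq d u) = scaleq (c * d) u.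
Proof. by rewrite -[u]pK -!pZ scalerA. Qed.
Let scale1q : left_id 1 scaleq.
Proof. by move=> u; rewrite -[u]pK -!pZ scale1r. Qed.
Let scaleqDr : right_distributive scaleq +%R.
Proof. by move=> c u v; rewrite -[u]pK -[v]pK -pD -!pZ -pD scalerDr. Qed.
Let scaleqDl u : {morph scaleq^~ u : c d / c + d}.
Proof. by move=> c d; rewrite -[u]pK -!pZ -pD scalerDl. Qed.

HB.instance Definition _ := GRing.Zmodule_isLmodule.Build F Q
  scaleqA scale1q scaleqDr scaleqDl.

Let pZr c x : p (c *: x) = c *: p x.
Proof. exact: pZ. Qed.

Let scaleqAl (c : F) (u v : Q) : c *: (u * v) = c *: u * v.
Proof. by rewrite -[u]pK -[v]pK -pMr -!pZr -pMr scalerAl. Qed.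

HB.instance Definition _ := GRing.Lmodule_isLalgebra.Build F Q scaleqAl.

Let scaleqAr (c : F) (u v : Q) : c *: (u * v) = u * (c *: v).
Proof. by rewrite -[u]pK -[v]pK -pMr -!pZr -pMr scaleAr. Qed.

HB.instance Definition _ := GRing.Lalgebra_isAlgebra.Build F Q scaleqAr.

Lemma quotient_algebra : exists (R : algType F) (pi : {lrmorphism A -> R}),
  (forall r, exists x, pi x = r) /\ (forall x, pi x = 0 <-> J x).
Proof.
exists Q.
have plin : linear p by move=> c x y; rewrite pD pZr.
have pmul : monoid_morphism p by split => // x y; rewrite pMr.
exists (HB.pack_for {lrmorphism A -> Q} p
  (GRing.isLinear.Build F A Q *:%R p plin)
  (GRing.isMonoidMorphism.Build A Q p pmul)).
split => [r|x]; first by exists (repr r); exact: pK.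
rewrite -{2}[x]subr0 -p_eq /=; split => [->|->].
  exact/esym/pi_zeror.
exact: pi_zeror.
Qed.

End QuotientAlgebra.

(** * Wedderburn's theorem for the span of the monomials [a ^+ i * x ^+ j] *)

Section FiniteTwistedSpan.
Variables (R : nzRingType) (p n k : nat) (a x : R).
Hypotheses (pR : p \in [pchar R]) (n_gt0 : (0 < n)%N).
Hypotheses (an1 : a ^+ n = 1) (xn1 : x ^+ n = 1) (xa : x * a = a ^+ k * x).

Let p_gt0 : (0 < p)%N.
Proof. exact/prime_gt0/(pcharf_prime pR). Qed.

(** Coefficients in ['I_p] suffice because [p] is zero in [R], and they keep the span finite. *)
Definition span_eval (c : {ffun 'I_n * 'I_n -> 'I_p}) : R :=
  \sum_(e : 'I_n * 'I_n) (a ^+ e.1 * x ^+ e.2) *+ c e.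

Definition twisted_span : {pred R} := fun r => [exists c, r == span_eval c].

Lemma natmul_span (c : 'I_n * 'I_n -> nat) :
  \sum_(e : 'I_n * 'I_n) (a ^+ e.1 * x ^+ e.2) *+ c e \in twisted_span.
Proof.
apply/existsP; exists [ffun e => Ordinal (ltn_pmod (c e) p_gt0)]; apply/eqP.
apply: eq_bigr => e _; rewrite ffunE /= {1}(divn_eq (c e) p) mulrnDr.
by rewrite mulrnA (mulrn_pchar pR) add0r.
Qed.

Lemma spanB : {in twisted_span &, forall u v, u - v \in twisted_span}.
Proof.
move=> u v /existsP[c /eqP->] /existsP[d /eqP->].
(* Modulo [p], the natural number [p.-1 * d e] stands for the coefficient [- d e]. *)
have -> : span_eval c - span_eval d =
    \sum_(e : 'I_n * 'I_n) (a ^+ e.1 * x ^+ e.2) *+ (c e + p.-1 * d e).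
  rewrite -sumrB; apply: eq_bigr => e _; rewrite mulrnDr; congr (_ + _).
  apply/eqP; rewrite -[- _]add0r eq_sym -subr_eq opprK.
  rewrite -mulrnDr -mulSnr prednK // mulnC mulrnA.
  by rewrite (mulrn_pchar pR).
exact: natmul_span.
Qed.

Lemma span_monomial i j : a ^+ i * x ^+ j \in twisted_span.
Proof.
pose e0 : 'I_n * 'I_n :=
  (Ordinal (ltn_pmod i n_gt0), Ordinal (ltn_pmod j n_gt0)).
have -> : a ^+ i * x ^+ j = \sum_(e : 'I_n * 'I_n) (a ^+ e.1 * x ^+ e.2) *+ (e == e0).
  rewrite (bigD1 e0) //= eqxx mulr1n big1 ?addr0 => [|e /negPf->].
    by rewrite !expr_mod.
  by rewrite mulr0n.
exact: natmul_span.
Qed.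

(** Each [x] that passes a power of [a] multiplies its exponent by [k]; this brings products of
    monomials back to normal form. *)
Lemma twisted_commute i j : x ^+ j * a ^+ i = a ^+ (i * k ^ j) * x ^+ j.
Proof.
have xai m : x * a ^+ m = a ^+ (m * k) * x.
  elim: m => [|m IH]; first by rewrite mul0n !expr0 mulr1 mul1r.
  by rewrite exprSr mulrA IH -mulrA xa mulrA -exprD mulSnr.
elim: j => [|j IH]; first by rewrite expn0 muln1 !expr0 mul1r mulr1.
by rewrite exprS -mulrA IH mulrA xai -mulrA expnSr mulnA.
Qed.

Fact twisted_span_subring : subring_closed twisted_span.
Proof.
have S0 : 0 \in twisted_span.
  by rewrite -(subrr (a ^+ 0 * x ^+ 0)) spanB // span_monomial.
have SD u v : u \in twisted_span -> v \in twisted_span -> u + v \in twisted_span.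
  by move=> Su Sv; rewrite -[v]opprK spanB // -[- v]add0r spanB.
have SMn u m : u \in twisted_span -> u *+ m \in twisted_span.
  by move=> Su; elim: m => [|m IH]; rewrite ?mulr0n // mulrS SD.
split; [|exact: spanB|].
  by have := span_monomial 0 0; rewrite !expr0 mulr1.
move=> u v /existsP[c /eqP->] /existsP[d /eqP->].
rewrite mulr_suml; apply: (big_ind (fun r => r \in twisted_span)) => // e _.
rewrite mulr_sumr; apply: (big_ind (fun r => r \in twisted_span)) => // e' _.
rewrite mulrnAl mulrnAr; do 2!apply: (SMn).
rewrite mulrA -[_ * a ^+ _]mulrA twisted_commute mulrA -exprD -mulrA -exprD.
exact: span_monomial.
Qed.

HB.instance Definition _ :=
  GRing.isSubringClosed.Build R twisted_span twisted_span_subring.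

Definition span_ring := {r : R | r \in twisted_span}.
HB.instance Definition _ := SubChoice.on span_ring.
HB.instance Definition _ := [SubChoice_isSubNzRing of span_ring by <:].

(** Choosing one family of coefficients per element embeds the span in a finite type. *)
Let coords (u : span_ring) : {ffun 'I_n * 'I_n -> 'I_p} :=
  xchoose (existsP (valP u)).
Let of_coords c : option span_ring := insub (span_eval c).
Let coordsK : pcancel coords of_coords.
Proof.
move=> u; rewrite /of_coords /coords; have /eqP <- := xchooseP (existsP (valP u)).
exact: valK.
Qed.

HB.instance Definition _ := Countable.copy span_ring (pcan_type coordsK).
HB.instance Definition _ : isFinite span_ring := PCanIsFinite coordsK.

Hypothesis span_pow : {in twisted_span, forall u, u != 0 -> u ^+ n = 1}.

(** Non-zero elements have order dividing [n]. Inversion must fix the non-units, whence the value 0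
    at 0. *)
Let invs (u : span_ring) : span_ring := if u == 0 then 0 else u ^+ n.-1.
Let units : {pred span_ring} := fun u => u != 0.

Let powV u : u != 0 -> u * u ^+ n.-1 = 1 :> span_ring.
Proof.
move=> u0; rewrite -exprS prednK //; apply/val_inj; rewrite rmorphXn rmorph1.
exact/span_pow/u0/(valP u).
Qed.
Let units_mulV : {in units, left_inverse 1 invs *%R}.
Proof.
move=> u u0; have u0' : u != 0 by [].
by rewrite /invs (negPf u0') -exprSr exprS powV.
Qed.
Let units_mulVr : {in units, right_inverse 1 invs *%R}.
Proof. by move=> u u0; rewrite /invs (negPf (u0 : u != 0)) powV. Qed.
Let units_intro u v : v * u = 1 /\ u * v = 1 -> u \in units.
Proof.
case=> vu1 _; apply: contraTneq (oner_neq0 span_ring) => u0.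
by rewrite -vu1 u0 mulr0 eqxx.
Qed.
Let units_out : {in [predC units], invs =1 id}.
Proof. by move=> u /negPn/eqP->; rewrite /invs eqxx. Qed.
HB.instance Definition _ := GRing.NzRing_hasMulInverse.Build span_ring
  units_mulV units_mulVr units_intro units_out.

(** The span is a finite ring without zero divisors, hence commutative by Wedderburn's theorem. *)
Lemma twisted_span_comm : x * a = a * x.
Proof.
have dom : GRing.integral_domain_axiom span_ring.
  move=> u v uv0; case: eqVneq => //= u0; apply/eqP.
  have := powV u0; rewrite -exprS exprSr => e.
  by rewrite -[v]mul1r -e -mulrA uv0 mulr0.
have Sa : a \in twisted_span by have := span_monomial 1 0; rewrite mulr1.
have Sx : x \in twisted_span by have := span_monomial 0 1; rewrite mul1r.
pose u : span_ring := exist _ x Sx; pose v : span_ring := exist _ a Sa.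
by have /(congr1 val) := finDomain_mulrC dom u v; rewrite !rmorphM.
Qed.

End FiniteTwistedSpan.

(** * Jacobson's commutativity theorem in the division case *)

Section DivisionSubring.
Variables (R : nzRingType) (S : subringClosed R) (p n : nat).
Hypotheses (pR : p \in [pchar R]) (np : ~~ (p %| n)%N).
Hypothesis powS : {in S, forall y, y != 0 -> y ^+ n = 1}.

Let n_gt0 : (0 < n)%N.
Proof. by case: n np => //; rewrite dvdn0. Qed.

(** A non-zero [x] in [S] has the inverse [x ^+ n.-1], so it can be cancelled. *)
Lemma division_subring_mulr_eq0 :
  {in S &, forall x y, (x * y == 0) = (x == 0) || (y == 0)}.
Proof.
move=> x y Sx Sy; case: (eqVneq x 0) => [->|x0]; first by rewrite mul0r eqxx.
apply/eqP/eqP => [xy0|->]; last by rewrite mulr0.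
by rewrite -[y]mul1r -(powS Sx x0) -(prednK n_gt0) exprSr -mulrA xy0 mulr0.
Qed.

(* If [a] does not commute with [t], then conjugation by [a] on the powers of
   [a] times [t] is diagonalised by a discrete Fourier transform; a non-zero
   eigenvector [x] for a non-trivial eigenvalue normalises the group generated
   by [a] without centralising it. *)
Lemma normalising_element a t : a \in S -> t \in S -> t * a != a * t ->
  exists x k, [/\ x \in S, x != 0, x * a = a ^+ k * x & x * a != a * x].
Proof.
move=> Sa St ta; have a0 : a != 0.
  by apply: contraNneq ta => ->; rewrite mul0r mulr0.
have an1 := powS Sa a0; pose b := a ^+ n.-1.
have ab1 : a * b = 1 by rewrite -exprS prednK.
have ba1 : b * a = 1 by rewrite -exprSr prednK.
have abC : GRing.comm a b by rewrite /GRing.comm ab1 ba1.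
have [N primN Nn] := prim_order_exists n_gt0 an1.
have aN1 := prim_expr_order primN.
have N_gt0 := prim_order_gt0 primN.
have bN1 : b ^+ N = 1 by rewrite -exprM mulnC exprM aN1 expr1n.
(* Since [b] is the inverse of [a], this is a conjugate of [t] by [a ^+ l], weighted by
   [a ^+ (i * l)]; [X i] is the [i]-th Fourier coefficient. *)
pose term i l := a ^+ (i * l) * b ^+ l * t * a ^+ l.
pose X i := \sum_(l < N) term i l.
have Sterm i l : term i l \in S by rewrite !rpredM ?rpredX.
have SX i : X i \in S by rewrite rpred_sum.
have termS i l : term i l.+1 = a ^+ i * b * term i l * a.
  rewrite /term mulnS exprD [a ^+ l.+1]exprSr [b ^+ l.+1]exprS !mulrA.
  congr (_ * _ * _ * _); rewrite -!mulrA; congr (_ * _).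
  by rewrite !mulrA; congr (_ * _); apply/commr_sym/commrX/commr_sym.
(* Conjugation shifts [l] by one, and the sum is unchanged because the terms for [l = N] and [l = 0]
   agree. *)
have X_shift i : X i = a ^+ i * b * X i * a.
  rewrite {2}/X mulr_sumr mulr_suml; under eq_bigr do rewrite -termS.
  have : \sum_(l < N) term i l + term i N = term i 0%N + \sum_(l < N) term i l.+1.
    pose f (l : 'I_N.+1) := term i l.
    exact: etrans (esym (@big_ord_recr _ 0 +%R N f)) (@big_ord_recl _ 0 +%R N f).
  rewrite addrC.
  have -> : term i N = term i 0.
    by rewrite /term mulnC exprM aN1 bN1 expr1n muln0 !expr0.
  by move/addrI.
(* As [a ^+ n.-1] inverts [a], the exponent stands for [1 - i]. *)
have Xa i : X i * a = a ^+ (1 + i * n.-1) * X i.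
  rewrite exprD expr1 mulnC exprM -/b {2}X_shift !mulrA.
  suff -> : a * b ^+ i * a ^+ i * b = 1 by rewrite mul1r.
  rewrite -(mulrA a) -exprMn_comm; last exact: commr_sym.
  by rewrite ba1 expr1n mulr1.
(* Fourier inversion: for [l] non-zero, [a ^+ l] differs from 1, so its geometric sum over [N] terms
   vanishes. *)
have sumX : \sum_(i < N) X i = t *+ N.
  rewrite exchange_big (bigD1 (Ordinal N_gt0)) //= [X in _ + X]big1 ?addr0.
    under eq_bigr do rewrite /term muln0 !expr0 !mul1r mulr1.
    by rewrite sumr_const card_ord.
  move=> l l0; rewrite -!mulr_suml.
  under eq_bigr do rewrite mulnC exprM.
  suff -> : \sum_(i < N) a ^+ l ^+ i = 0 by rewrite !mul0r.
  apply/eqP; have /eqP := subrX1 (a ^+ l) N.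
  rewrite -exprM mulnC exprM aN1 expr1n subrr eq_sym.
  rewrite division_subring_mulr_eq0 ?rpredB ?rpredX ?rpred1 //; last first.
    by rewrite rpred_sum // => i _; rewrite !rpredX.
  case/orP => //; rewrite subr_eq0 -(prim_order_dvd primN) => /dvdn_leq.
  by rewrite lt0n => /(_ l0); rewrite leqNgt ltn_ord.
(* If only [X 0] could be non-zero, [t *+ N] would equal [X 0], which commutes with [a]. As [N]
   divides [n], it is invertible modulo [p], so [t] would commute with [a]. *)
have /existsP[i /andP[i0 Xi0]] : [exists i : 'I_N, (i != 0 :> nat) && (X i != 0)].
  apply: contraNT ta => /existsPn X0; have : X 0%N * a = a * X 0%N.
    by rewrite Xa mul0n addn0 expr1.
  have -> : X 0%N = t *+ N.
    rewrite -sumX (bigD1 (Ordinal N_gt0)) //= big1 ?addr0 // => i i0.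
    have := X0 i; rewrite negb_and !negbK => /orP[i00|/eqP//].
    by case/eqP: i0; apply/val_inj/eqP.
  rewrite mulrnAl mulrnAr => /eqP; rewrite -subr_eq0 -mulrnBl -[X in X == _]mulr_natr.
  have [u uN] : exists u, (N%:R : R) * u = 1.
    have : coprime N p.
      rewrite coprime_sym prime_coprime ?(pcharf_prime pR) //.
      by apply: contra np => /dvdn_trans; apply.
    case/(coprimeP _ N_gt0) => -[u v] /= uv1; exists u%:R.
    have /(congr1 (fun m => m%:R : R)) : (u * N = 1 + v * p)%N by lia.
    by rewrite natrD !natrM (pcharf0 pR) mulr0 addr0 -commr_nat.
  move/eqP/(congr1 ( *%R^~ u)); rewrite -mulrA uN mulr1 mul0r => /eqP.
  by rewrite subr_eq0.
exists (X i), (1 + i * n.-1)%N; split=> //; apply: contraNneq i0 => Xai.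
have : (a ^+ (i * n.-1) - 1) * X i == 0.
  rewrite mulrBl mul1r subr_eq0 -[X in _ == X]mul1r -ba1 -mulrA -Xai Xa exprD expr1.
  by rewrite !mulrA ba1 mul1r.
rewrite division_subring_mulr_eq0 ?rpredB ?rpredX ?rpred1 // (negPf Xi0) orbF.
rewrite subr_eq0 => /eqP bi1.
(* Commutation has forced the inverse of [a ^+ i] to be 1, so the order [N] of [a] divides [i],
   against [0 < i < N]. *)
have : (N %| i)%N.
  rewrite (prim_order_dvd primN); have := congr1 ( *%R (a ^+ i)) bi1.
  by rewrite mulr1 -exprD -mulnS prednK // mulnC exprM an1 expr1n => <-.
by apply: contraTT => i_neq0; rewrite gtnNdvd ?lt0n ?ltn_ord.
Qed.

(* Jacobson's commutativity theorem in the division case: a normalising element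
   would make the finite span of the [a^i x^j] a non-commutative division ring,
   against Wedderburn's theorem. *)
Theorem division_subring_comm : {in S &, forall a t, a * t = t * a}.
Proof.
move=> a t Sa St; apply/eqP; apply/negPn/negP; rewrite eq_sym => ta.
have [x [k [Sx x0 xa /eqP[]]]] := normalising_element Sa St ta.
have a0 : a != 0 by apply: contraNneq ta => ->; rewrite mul0r mulr0.
apply: (twisted_span_comm pR n_gt0 (powS Sa a0) (powS Sx x0) xa).
move=> u /existsP[c /eqP->]; apply: powS; apply: rpred_sum => e _.
by rewrite rpredMn // rpredM ?rpredX.
Qed.

End DivisionSubring.

(** * Frobenius powers and the Artin-Schreier map in characteristic 2 *)

Lemma exprD2k (R : nzRingType) (x y : R) (k : nat) :
  2%N \in [pchar R] -> GRing.comm x y ->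
  (x + y) ^+ (2 ^ k) = x ^+ (2 ^ k) + y ^+ (2 ^ k).
Proof.
move=> R2 xy; elim: k => [|k IH]; first by rewrite !expr1.
rewrite expnSr !exprM IH.
apply: (pFrobenius_autD_comm R2); apply/commrX/commr_sym.
exact/commrX/commr_sym.
Qed.

Section FiniteFieldChar2.
Variables (F : finFieldType) (q : nat).
Hypotheses (char2 : 2%N \in [pchar F]) (cardF : #|F| = q).

Lemma card_pow2 : exists2 k, (0 < k)%N & q = (2 ^ k)%N.
Proof.
have qE : q = (2 ^ logn 2 q)%N by rewrite -cardF; exact: (card_pprimeChar char2).
exists (logn 2 q) => //; rewrite lt0n; apply: contraTneq (finNzRing_gt1 F).
by move=> k0; rewrite cardF qE k0.
Qed.

Let add2 (x : F) : x + x = 0.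
Proof. exact: addrr_pchar2. Qed.

Let wp (x : F) := x ^+ 2 + x.

Let wpD x y : wp (x + y) = wp x + wp y.
Proof. by rewrite /wp sqrrD mulr2n add2 addr0 addrACA. Qed.

Let wp_eq x y : wp x = wp y -> y = x \/ y = x + 1.
Proof.
move=> /eqP; rewrite -subr_eq0 oppr_pchar2 // -wpD /wp expr2 -[X in _ + X]mulr1.
rewrite -mulrDr mulf_eq0 -[_ + _ + 1]addrA !addr_eq0 !oppr_pchar2 //.
by case/orP => /eqP ->; [left|right; rewrite -addrA add2 addr0].
Qed.

(* The additive map [x |-> x^2 + x] has kernel of order 2, so the
   complement of its image is a single coset. *)
Lemma artin_schreier_coset (b c : F) :
  (forall x, b <> x ^+ 2 + x) -> (forall x, c <> x ^+ 2 + x) ->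
  exists x, b + c = x ^+ 2 + x.
Proof.
move=> nb nc; pose V := [set wp x | x : F].
have [/imsetP[x _ ->]|nbc] := boolP (b + c \in V); first by exists x.
have cosetE d v : (v \in [set d + u | u in V]) = (v + d \in V).
  apply/imsetP/idP => [[u Vu ->]|Vvd]; first by rewrite addrAC add2 add0r.
  by exists (v + d); rewrite // addrCA add2 addr0.
have VD u v : u \in V -> v \in V -> u + v \in V.
  by move=> /imsetP[x _ ->] /imsetP[y _ ->]; rewrite -wpD imset_f.
have nV d : (forall x, d <> x ^+ 2 + x) -> d \notin V.
  by move=> nd; apply/imsetP => -[x _ /nd].
have dis d e : d + e \notin V -> [disjoint [set d + u | u in V] & [set e + u | u in V]].
  move=> nde; rewrite -setI_eq0; apply/eqP/setP => v; rewrite !inE !cosetE.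
  apply: contraNF nde => /andP[vd ve].
  by have := VD _ _ vd ve; rewrite addrACA add2 add0r.
have cardV d : #|[set d + u | u in V]| = #|V| by apply/card_imset/addrI.
(* Every fibre of [wp] lies in a pair [x], [x + 1]. *)
have V2 : (#|F| <= #|V| * 2)%N.
  rewrite -[#|F|]sum1_card (partition_big wp (mem V)) /=; last first.
    by move=> x _; rewrite imset_f.
  rewrite -sum_nat_const; apply: leq_sum => v /imsetP[x _ ->].
  rewrite sum1_card; apply: (@leq_trans #|[set x; x + 1]|); last first.
    by rewrite cards2; case: eqP.
  apply/subset_leq_card/subsetP => y; rewrite !inE => /eqP /esym /wp_eq [] ->.
    by rewrite eqxx.
  by rewrite eqxx orbT.
(* With [b + c] outside [V], the cosets of 0, [b] and [c] are pairwise disjoint, which contradicts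
   [V2]. *)
have V3 : (#|V| * 3 <= #|F|)%N.
  pose A := [set 0 + u | u in V]; pose B := [set b + u | u in V].
  pose C := [set c + u | u in V].
  have -> : (#|V| * 3 = #|A| + (#|B| + #|C|))%N by rewrite !cardV; lia.
  have /eqP cAB : #|A :|: B| == (#|A| + #|B|)%N.
    by rewrite (leq_card_setU A B).2 dis // add0r nV.
  have /eqP cABC : #|A :|: B :|: C| == (#|A :|: B| + #|C|)%N.
    rewrite (leq_card_setU (A :|: B) C).2 disjoints_subset subUset.
    by rewrite -!disjoints_subset !dis // add0r nV.
  by rewrite addnA -cAB -cABC max_card.
have : (0 < #|V|)%N by apply/card_gt0P; exists (wp 0); rewrite imset_f.
lia.
Qed.

End FiniteFieldChar2.

(** * Frobenius on elements quadratic over [F] *)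

Section QuadraticElements.
Variables (F : finFieldType) (q : nat) (b : F) (R : algType F).
Hypotheses (char2 : 2%N \in [pchar F]) (cardF : #|F| = q).
Hypothesis hb : forall x : F, b <> x ^+ 2 + x.

Lemma alg_pchar2 : 2%N \in [pchar R].
Proof. exact: (rmorph_pchar (in_alg R)). Qed.

Lemma alg_addxx (x : R) : x + x = 0.
Proof. exact/addrr_pchar2/alg_pchar2. Qed.

Lemma alg_opp (x : R) : - x = x.
Proof. exact/oppr_pchar2/alg_pchar2. Qed.

Lemma scalar_inj : injective (fun c : F => c%:A : R).
Proof. exact: fmorph_inj (in_alg R). Qed.

Lemma scalar_pow (c : F) n : c%:A ^+ n = (c ^+ n)%:A :> R.
Proof. by rewrite -[LHS](rmorphXn (in_alg R)). Qed.

Lemma scalar_comm (c : F) (x : R) : GRing.comm c%:A x.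
Proof. by rewrite /GRing.comm mulr_algl mulr_algr. Qed.

Lemma exprDq (x y : R) : GRing.comm x y -> (x + y) ^+ q = x ^+ q + y ^+ q.
Proof.
have [k _ ->] := card_pow2 char2 cardF.
exact/exprD2k/alg_pchar2.
Qed.

Lemma exprZq (c : F) (x : R) : (c *: x) ^+ q = c *: x ^+ q.
Proof. by rewrite exprZn -cardF expf_card. Qed.

(** The polynomial [X^q - X] is the product of all [X - c] with [c] in [F]; at [y] every factor is
    cancellable, so the product is non-zero. *)
Lemma frobenius_moves (y : R) :
  (forall c : F, GRing.lreg (y - c%:A)) -> y ^+ q != y.
Proof.
move=> reg; rewrite -subr_eq0.
have -> : y ^+ q - y = \prod_(c : F) (y - c%:A).
  have := congr1 (horner_alg y) (finField_genPoly F).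
  rewrite rmorphB rmorphXn /= horner_algX cardF => ->.
  rewrite rmorph_prod; apply: eq_bigr => c _.
  by rewrite rmorphB /= horner_algX horner_algC.
apply/lreg_neq0; apply: (big_ind (fun r : R => GRing.lreg r)) => //.
  exact: lreg1.
exact: lregM.
Qed.

Let sq (e : F) (t : R) (c : F) : t * t = t + e%:A ->
  (t + c%:A) ^+ 2 = t + (e + c ^+ 2)%:A.
Proof.
move=> tt; rewrite (exprD2k 1 alg_pchar2) ?expn1; last exact/commr_sym/scalar_comm.
by rewrite scalar_pow expr2 tt -addrA -scalerDl.
Qed.

(** Squaring changes [t] plus a scalar into [t] plus a scalar, and [q] is a power of 2. *)
Lemma artin_schreier_shift (e : F) (t : R) : t * t = t + e%:A ->
  exists c : F, t ^+ q = t + c%:A.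
Proof.
move=> tt; have [k _ ->] := card_pow2 char2 cardF.
elim: k => [|k [c IH]]; first by exists 0; rewrite scale0r addr0.
by exists (e + c ^+ 2); rewrite expnSr exprM IH (sq c tt).
Qed.

(** Comparing the square of [t ^+ q] with the [q]-th power of [t ^+ 2] gives [c ^+ 2 = c] for the
    shift [c]. The value 0 is excluded because all [t - d] are cancellable. *)
Lemma artin_schreier_frobenius (t : R) : t * t = t + b%:A -> t ^+ q = t + 1.
Proof.
move=> tt; have [c tq] := artin_schreier_shift tt.
have : c * (c - 1) == 0.
  have : (t ^+ q) ^+ 2 = (t ^+ 2) ^+ q by rewrite -!exprM mulnC.
  rewrite tq (sq c tt) [t ^+ 2]expr2 tt exprDq; last exact/commr_sym/scalar_comm.
  rewrite scalar_pow -cardF expf_card cardF tq -addrA -scalerDl => /addrI/scalar_inj.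
  by rewrite addrC => /addIr cc; rewrite mulrBr mulr1 -expr2 cc subrr.
rewrite mulf_eq0 subr_eq0 => /orP[/eqP c0|/eqP c1]; last first.
  by rewrite tq c1 scale1r.
suff /frobenius_moves/eqP[] : forall d, GRing.lreg (t - d%:A).
  by rewrite tq c0 scale0r addr0.
(* This is the norm of [t - d], the product with its conjugate [t + 1 - d]; it is non-zero by the
   choice of [b]. *)
move=> d; pose e := b + d ^+ 2 + d.
have e0 : e != 0.
  apply/eqP => e0; apply: (hb (x := d)); apply/eqP.
  by rewrite -subr_eq0 oppr_pchar2 // addrA; apply/eqP.
have prod : (t + 1 - d%:A) * (t - d%:A) = e%:A.
  rewrite alg_opp addrAC mulrDl mul1r -expr2 (sq d tt) addrACA.
  by rewrite alg_addxx add0r -scalerDl.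
have K x : e^-1 *: (t + 1 - d%:A) * ((t - d%:A) * x) = x.
  by rewrite -scalerAl mulrA prod mulr_algl scalerA mulVf // scale1r.
exact: can_inj K.
Qed.

Lemma quadratic_frobenius (t : R) (u w : F) : t * t = t + b%:A ->
  (u%:A + w *: t) ^+ q = (u + w)%:A + w *: t.
Proof.
move=> tt; rewrite exprDq; last exact: scalar_comm.
rewrite scalar_pow exprZq (artin_schreier_frobenius tt) -{1}cardF expf_card.
by rewrite scalerDr [w *: t + _]addrC addrA -scalerDl.
Qed.

End QuadraticElements.

(** * Coordinates in the crossed product generated by [t] and [j] *)

Section Coordinates.
Variables (F : finFieldType) (b : F).
Hypothesis char2 : 2%N \in [pchar F].
Implicit Types (k l : F * F) (c d : (F * F) * (F * F)).

(** The Galois conjugation [t |-> t + 1] in the basis [1, t]. *)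
Definition qconj k : F * F := (k.1 + k.2, k.2).
(** The product of [F[t]] under [t * t = t + b]. *)
Definition qmul k l : F * F :=
  (k.1 * l.1 + b * (k.2 * l.2), k.1 * l.2 + k.2 * l.1 + k.2 * l.2).
Definition qscale (s : F) k : F * F := (s * k.1, s * k.2).
(** The crossed product law: [j] moves past [F[t]] by conjugation and [j * j = 1]. *)
Definition cmul c d : (F * F) * (F * F) :=
  (qmul c.1 d.1 + qmul c.2 (qconj d.2), qmul c.1 d.2 + qmul c.2 (qconj d.1)).
Definition cscale (s : F) c := (qscale s c.1, qscale s c.2).
Definition cone : (F * F) * (F * F) := ((1, 0), 0).

(* Coordinates with respect to [1, t, j, tj]; the flags [okt] and [okj] say
   whether [t] and [j] are available, and force the corresponding coordinates
   to vanish otherwise. *)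
Definition admissible (okt okj : bool) c :=
  (okt || (c.1.2 == 0) && (c.2.2 == 0)) && (okj || (c.2 == 0)).

Variables (X : algType F) (t j : X) (okt okj : bool).
Hypotheses (tt : okt -> t * t = t + b%:A) (jj : okj -> j * j = 1).
Hypothesis jt : okt -> okj -> j * t = (t + 1) * j.

Definition qeval k : X := k.1%:A + k.2 *: t.
Definition ceval c : X := qeval c.1 + qeval c.2 * j.

Lemma qevalD k l : qeval (k + l) = qeval k + qeval l.
Proof. by rewrite /qeval !scalerDl addrACA. Qed.

Lemma qevalZ s k : qeval (qscale s k) = s *: qeval k.
Proof. by rewrite /qeval scalerDr !scalerA. Qed.

Lemma qeval0 : qeval 0 = 0.
Proof. by rewrite /qeval !scale0r addr0. Qed.

Lemma qevalM k l : okt || (k.2 == 0) && (l.2 == 0) ->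
  qeval (qmul k l) = qeval k * qeval l.
Proof.
case/orP => [/tt E|/andP[/eqP k0 /eqP l0]]; last first.
  rewrite /qeval /qmul /= k0 l0 !(mulr0, mul0r, addr0, scale0r).
  by rewrite mulr_algl scalerA.
rewrite /qeval /qmul /= mulrDl !mulrDr !mulr_algl -!scalerAl mulr_algr -scalerAr E.
rewrite !scalerA !scalerDr !scalerDl !scalerA [b * _]mulrC.
by rewrite -!addrA; congr (_ + _); rewrite addrC -!addrA.
Qed.

Lemma qconjP k : okj -> okt || (k.2 == 0) -> j * qeval k = qeval (qconj k) * j.
Proof.
move=> okj1 /orP[okt1|/eqP k0]; rewrite /qeval /qconj /=; last first.
  by rewrite k0 !scale0r !addr0 mulr_algl mulr_algr.
rewrite mulrDr mulr_algr -scalerAr jt // scalerAl -[k.1 *: j]mulr_algl -mulrDl.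
by congr (_ * _); rewrite scalerDr scalerDl -[RHS]addrA [k.2%:A + _]addrC.
Qed.

Lemma cevalD c d : ceval (c + d) = ceval c + ceval d.
Proof. by rewrite /ceval !qevalD mulrDl addrACA. Qed.

Lemma cevalZ s c : ceval (cscale s c) = s *: ceval c.
Proof. by rewrite /ceval !qevalZ [RHS]scalerDr scalerAl. Qed.

Lemma ceval0 : ceval 0 = 0.
Proof. by rewrite /ceval qeval0 mul0r addr0. Qed.

Lemma ceval1 : ceval cone = 1.
Proof. by rewrite /ceval qeval0 mul0r addr0 /qeval scale1r scale0r addr0. Qed.

Lemma admissibleD c d : admissible okt okj c -> admissible okt okj d ->
  admissible okt okj (c + d).
Proof.
rewrite /admissible => /andP[/orP c1 /orP c2] /andP[/orP d1 /orP d2].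
apply/andP; split.
  case: c1 => [->//|/andP[/eqP c3 /eqP c4]]; case: d1 => [->//|/andP[/eqP d3 /eqP d4]].
  by rewrite /= c3 c4 d3 d4 addr0 eqxx orbT.
case: c2 => [->//|/eqP c3]; case: d2 => [->//|/eqP d3].
by rewrite /= c3 d3 addr0 eqxx orbT.
Qed.

Lemma qmul0 l : qmul 0 l = 0.
Proof. by rewrite /qmul /= !mul0r mulr0 !addr0. Qed.

Lemma qmulr0 l : qmul l 0 = 0.
Proof. by rewrite /qmul /= !mulr0 !addr0. Qed.

Lemma admissibleZ s c : admissible okt okj c -> admissible okt okj (cscale s c).
Proof.
move=> /andP[/orP c1 /orP c2]; apply/andP; split; apply/orP.
  case: c1 => [->|/andP[/eqP c3 /eqP c4]]; [by left|right].
  by rewrite /= c3 c4 mulr0 eqxx.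
case: c2 => [->|/eqP c3]; [by left|right].
by rewrite /cscale /= c3 /qscale /= mulr0.
Qed.

Lemma admissibleM c d : admissible okt okj c -> admissible okt okj d ->
  admissible okt okj (cmul c d).
Proof.
move=> /andP[/orP c1 /orP c2] /andP[/orP d1 /orP d2].
apply/andP; split; apply/orP.
  case: c1 => [->|/andP[/eqP c3 /eqP c4]]; [by left|].
  case: d1 => [->|/andP[/eqP d3 /eqP d4]]; [by left|right].
  by rewrite /= c3 c4 d3 d4 !(mulr0, mul0r, addr0) eqxx.
case: c2 => [->|/eqP c3]; [by left|].
case: d2 => [->|/eqP d3]; [by left|right].
by rewrite /cmul /= c3 d3 qmul0 qmulr0 addr0.
Qed.

(** One formula computes products for any [t] and [j] obeying the relations required by the flags,
    so coordinates can be shared between [R] and the matrices. *)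
Lemma cevalM c d : admissible okt okj c -> admissible okt okj d ->
  ceval (cmul c d) = ceval c * ceval d.
Proof.
move=> /andP[c1 c2] /andP[d1 d2].
have okq k l : k = c.1 \/ k = c.2 ->
    l = d.1 \/ l = d.2 \/ l = qconj d.1 \/ l = qconj d.2 ->
    okt || (k.2 == 0) && (l.2 == 0).
  case/orP: c1 => [->//|/andP[/eqP c3 /eqP c4]].
  case/orP: d1 => [->//|/andP[/eqP d3 /eqP d4]].
  by case=> -> [->|[->|[->|->]]]; rewrite /= ?c3 ?c4 ?d3 ?d4 eqxx orbT.
rewrite /ceval /= !qevalD !qevalM; try by apply: okq; tauto.
case/orP: (c2) => [okj1|/eqP ->]; last first.
  rewrite qeval0 !mul0r !addr0; move: (qeval _) (qeval _) (qeval _) => A C D.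
  by rewrite mulrDr mulrA.
have cj k : k = d.1 \/ k = d.2 -> qeval (qconj k) * j = j * qeval k.
  move=> kd; apply/esym/qconjP => //; case/orP: (d1) => [->//|/andP[/eqP d3 /eqP d4]].
  by case: kd => ->; rewrite ?d3 ?d4 eqxx orbT.
move: (cj d.1 (or_introl erefl)) (cj d.2 (or_intror erefl)) (jj okj1).
move: (qeval d.1) (qeval d.2) (qeval (qconj d.1)) (qeval (qconj d.2)).
move: (qeval c.1) (qeval c.2) => A B C D C' D' jC jD jj1.
rewrite !mulrDl !mulrDr !mulrA -[B * j * C]mulrA -jC -[B * j * D]mulrA -jD !mulrA.
rewrite -[_ * j * j]mulrA jj1 mulr1 -!addrA; congr (_ + _).
by rewrite addrC -!addrA.
Qed.

End Coordinates.

(** * Structure of the quotient once non-zero even elements are invertible *)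

Section GradedDivisionAlgebra.
Variables (F : finFieldType) (q : nat) (b : F) (R : algType F).
Hypotheses (char2 : 2%N \in [pchar F]) (cardF : #|F| = q).
Hypothesis hb : forall x : F, b <> x ^+ 2 + x.
Variables (S : subringClosed R) (T : R -> Prop).
Hypothesis scalarS : forall c : F, c%:A \in S.
Hypothesis powS : {in S, forall y, y != 0 -> y ^+ (q ^ 2 - 1) = 1}.
Hypothesis oddZ : forall (c : F) z, T z -> T (c *: z).
Hypothesis oddM : forall z z', T z -> T z' -> z * z' \in S.
Hypothesis twist : forall z y, T z -> y \in S -> z * y = y ^+ q * z.
Hypothesis oddX : forall z, T z -> z ^+ (2 * q ^ 2 - 1) = z.

Let add2 (x : R) : x + x = 0.
Proof. exact: alg_addxx. Qed.

Let q_even : (2 %| q)%N.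
Proof. by have [[|k] // _ ->] := card_pow2 char2 cardF; rewrite expnS dvdn_mulr. Qed.

Let q_gt1 : (1 < q)%N.
Proof. by rewrite -cardF finNzRing_gt1. Qed.

Let n_odd : ~~ (2 %| q ^ 2 - 1)%N.
Proof.
by rewrite dvdn_subr ?dvdn1 ?expn_gt0 ?(ltnW q_gt1) // dvdn_exp.
Qed.

Let mulS0 : {in S &, forall x y, (x * y == 0) = (x == 0) || (y == 0)}.
Proof. exact: division_subring_mulr_eq0 n_odd powS. Qed.

Let commS : {in S &, forall x y, x * y = y * x}.
Proof. exact: division_subring_comm (alg_pchar2 R char2) n_odd powS. Qed.

Let frob2 : {in S, forall y, (y ^+ q) ^+ q = y}.
Proof.
move=> y Sy; rewrite -exprM mulnn; have [->|y0] := eqVneq y 0.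
  by rewrite expr0n expn_eq0 (gtn_eqF (ltnW q_gt1)).
by rewrite -[(q ^ 2)%N](@subnK 1) ?expn_gt0 ?(ltnW q_gt1) // exprD powS // mul1r.
Qed.

(** If [y] were no scalar, every [y - c] would be a non-zero element of [S], hence cancellable, and
    Frobenius would move [y]. *)
Lemma frobenius_fixed y : y \in S -> y ^+ q = y -> exists c : F, y = c%:A.
Proof.
move=> Sy yq; have [/existsP[c /eqP]|/existsPn nc] := boolP [exists c : F, y == c%:A].
  by exists c.
suff /(frobenius_moves cardF)/eqP[] : forall c : F, GRing.lreg (y - c%:A) by [].
move=> c; have /powS : y - c%:A \in S by rewrite rpredB.
rewrite subr_eq0 => /(_ (nc c)) inv.
(* The power [q ^ 2 - 2] is the inverse, since the power [q ^ 2 - 1] is 1. *)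
apply: (@can_inj _ _ _ ( *%R ((y - c%:A) ^+ (q ^ 2 - 2)))).
move=> x; rewrite mulrA -exprSr -subSn ?inv ?mul1r //.
by rewrite (@leq_trans (2 ^ 2)) // leq_exp2r.
Qed.

(** Frobenius is an involution on [S], so traces [y + y ^+ q] are scalars. A non-scalar [y] divided
    by its trace gives [w] with [w ^+ q = w + 1]; then [w * w + w] is a scalar [d], and shifting [w]
    by a scalar turns [d] into [b]. *)
Lemma even_part : exists (okt : bool) (t : R), [/\ okt -> t * t = t + b%:A,
  okt -> t \in S &
  {in S, forall y, exists2 k, okt || (k.2 == 0) & y = qeval t k}].
Proof.
have [allF|] := pselect (forall y, y \in S -> exists c : F, y = c%:A).
  exists false, 0; split=> // y /allF[c ->]; exists (c, 0); rewrite ?eqxx //.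
  by rewrite /qeval scale0r addr0.
move/existsNP => [y /not_implyP[Sy yF]].
have trace u : u \in S -> exists c : F, u + u ^+ q = c%:A.
  move=> Su; apply: frobenius_fixed; first by rewrite rpredD ?rpredX.
  rewrite (exprDq char2 cardF); last exact/commrX.
  by rewrite frob2 // addrC.
have [c yc] := trace y Sy.
have c0 : c != 0.
  apply/eqP => c0; apply/yF/frobenius_fixed => //.
  by rewrite -[y in RHS]addr0 -(scale0r 1) -c0 -yc addrA add2 add0r.
pose w := c^-1 *: y.
have Sw : w \in S by rewrite /w -mulr_algl rpredM.
have wF d : w <> d%:A.
  move=> wd; apply: yF; exists (c * d).
  by rewrite -scalerA -wd scalerA divff // scale1r.
have sqD x : (w + x%:A) * (w + x%:A) = w * w + (x ^+ 2)%:A.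
  have xw : x%:A * w = w * x%:A by exact: scalar_comm.
  rewrite mulrDl !mulrDr xw addrA -[w * w + _ + _]addrA add2 addr0.
  by rewrite mulr_algl scalerA -expr2.
have wq : w ^+ q = w + 1.
  rewrite (exprZq cardF) -[1](scale1r) -[X in X *: 1](mulVf c0) -scalerA -yc.
  by rewrite -scalerDr addrA add2 add0r.
have [d wd] : exists d : F, w * w + w = d%:A.
  apply: frobenius_fixed; first by rewrite rpredD ?rpredM.
  rewrite (exprDq char2 cardF); last exact/commr_sym/commrM.
  rewrite exprMn_comm // wq -[1]scale1r sqD expr1n.
  by rewrite addrACA add2 addr0.
(* Otherwise [(w + x) * (w + x + 1)] vanishes, making [w] a scalar. *)
have dV x : d <> x ^+ 2 + x.
  move=> dx; have : (w + x%:A) * (w + (x + 1)%:A) == 0.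
    rewrite scalerDl scale1r addrA mulrDr mulr1 sqD addrACA wd dx -!scalerDl.
    by rewrite addrr_pchar2 // scale0r.
  rewrite mulS0 ?rpredD // !addr_eq0 !(alg_opp char2).
  by case/orP => /eqP /wF.
have [x bd] := artin_schreier_coset char2 cardF hb dV.
pose t := w + x%:A.
have tt : t * t = t + b%:A.
  have -> : b = d + x ^+ 2 + x.
    by rewrite -addrA -bd addrCA addrr_pchar2 // addr0.
  rewrite sqD !scalerDl -wd /t [RHS]addrC -!addrA [x%:A + _]addrCA add2 addr0.
  by congr (_ + _); rewrite [RHS]addrCA add2 addr0.
exists true, t; split=> //; first by rewrite rpredD.
move=> u Su; have [e ue] := trace u Su.
(* As [t] has trace 1, the trace [e] of [u] is its coefficient on [t]; removing that part leaves a
   Frobenius-fixed element. *)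
have [g ug] : exists g : F, u + e *: t = g%:A.
  apply: frobenius_fixed; first by rewrite rpredD // -mulr_algl rpredM ?rpredD.
  rewrite (exprDq char2 cardF); last first.
    by apply: commS => //; rewrite -mulr_algl rpredM ?rpredD.
  rewrite (exprZq cardF) (artin_schreier_frobenius char2 cardF hb tt).
  by rewrite scalerDr -ue addrCA [u + _]addrC [u ^+ q + _]addrA add2 add0r addrC.
exists (g, e) => //; rewrite /qeval /= -ug -addrA add2 addr0 //.
Qed.

(** A non-zero odd [z] squares to a non-zero scalar, which has a square root in [F]. Dividing by the
    root gives [j], and [u = (u * j) * j] for odd [u]. *)
Lemma odd_part : exists (okj : bool) (j : R), [/\ okj -> j * j = 1,
  okj -> {in S, forall y, j * y = y ^+ q * j} &
  forall z, T z -> exists y, [/\ y \in S, okj || (y == 0) & z = y * j]].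
Proof.
have [T0|] := pselect (forall z, T z -> z = 0).
  by exists false, 0; split=> // z /T0 ->; exists 0; rewrite rpred0 mul0r eqxx.
move/existsNP => [z /not_implyP[Tz /eqP z0]].
have Szz : z * z \in S by exact: oddM.
have q2 : (2 <= 2 * q ^ 2 - 1)%N by have := q_gt1; nia.
have zz0 : z * z != 0.
  apply: contraNneq z0 => zz0.
  by rewrite -(oddX Tz) -(subnK q2) exprD expr2 zz0 mulr0.
have [c zzc] : exists c : F, z * z = c%:A.
  apply: frobenius_fixed => //; apply/eqP; rewrite -subr_eq0.
  (* This is [twist] for [z] and [z * z], multiplied by [z] on the right. *)
  have : ((z * z) ^+ q - z * z) * (z * z) == 0.
    rewrite mulrBl subr_eq0 [X in X == _]mulrA -twist //.
    by rewrite -!mulrA.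
  by rewrite mulS0 ?rpredB ?rpredX // (negPf zz0) orbF.
have [k k0 qk] := card_pow2 char2 cardF.
(* Since [q] is [2 ^ k], this power extracts square roots in [F]. *)
pose r := c ^+ (2 ^ k.-1).
have rr : r * r = c.
  by rewrite -expr2 -exprM -expnSr prednK // -qk -cardF expf_card.
have r0 : r != 0.
  by apply: contraNneq zz0 => r0; rewrite zzc -rr r0 mulr0 scale0r.
pose j := r^-1 *: z.
have Tj : T j by exact: oddZ.
have jj : j * j = 1.
  rewrite -scalerAl -scalerAr scalerA zzc scalerA -rr mulrACA mulVf // mulr1 scale1r //.
exists true, j; split=> // [_ y Sy|u Tu]; first exact: twist.
by exists (u * j); rewrite oddM // -mulrA jj mulr1.
Qed.

Lemma coordinates_exist : exists (okt okj : bool) (t j : R),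
  [/\ okt -> t * t = t + b%:A, okj -> j * j = 1,
      okt -> okj -> j * t = (t + 1) * j,
      {in S, forall y, exists c,
         [/\ admissible okt okj c, c.2 = 0 & y = ceval t j c]} &
      forall z, T z -> exists c,
         [/\ admissible okt okj c, c.1 = 0 & z = ceval t j c]].
Proof.
have [okt [t [tt St evS]]] := even_part.
have [okj [j [jj jy odT]]] := odd_part.
exists okt, okj, t, j; split=> //.
- move=> /[dup] /tt ttE /St St1 /jy -> //.
  by rewrite (artin_schreier_frobenius char2 cardF hb ttE).
- move=> y /evS[k kt ->]; exists (k, 0); split=> //.
    by rewrite /admissible /= !eqxx andbT orbT andbT.
  by rewrite /ceval qeval0 mul0r addr0.
move=> z /odT[y [Sy yj ->]]; have [y0|y0] := eqVneq y 0.
  exists 0; split=> //; last by rewrite ceval0 y0 mul0r.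
  by rewrite /admissible /= !eqxx !orbT.
have [k kt yk] := evS y Sy; exists (0, k); split=> //.
  rewrite /admissible /= eqxx andTb kt; move: yj; rewrite (negPf y0) orbF.
  by move=> ->.
by rewrite /ceval qeval0 add0r yk.
Qed.

End GradedDivisionAlgebra.

(** * The free graded algebra: induction, degrees and substitution *)

Section FreeAlgebra.
Variables (F : fieldType) (G : zmodType).
Local Notation P := (freealg F G).
Implicit Types (f : P) (w : {fmonom (gvar G)}) (x : gvar G).

Local Notation NU := (@nonunital F G).
Local Notation X x := (gX F x.1 x.2).

Lemma malg_word x (s : seq (gvar G)) :
  << FMonom (x :: s) >> = X x * << FMonom s >> :> P.
Proof.
rewrite malgM_def fgmulUU mulr1; congr << _ *g _ >>; apply/val_inj.
by rewrite /= fmM fmU; case: x.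
Qed.

Lemma malg_nil : << FMonom [::] >> = 1 :> P.
Proof. by congr << _ *g _ >>; apply/val_inj; rewrite /= fm1. Qed.

Lemma malg_sum f : f = \sum_(w <- msupp f) f@_w *: (<< w >> : P).
Proof.
rewrite {1}[f]monalgE; apply: eq_bigr => w _; apply/malgP => v.
by rewrite mcoeffZ !mcoeffU mulrnAr mulr1.
Qed.

Lemma malg_scaleAr (c : F) (f g : P) : c *: (f * g) = f * (c *: g).
Proof.
have Z a w : c *: (<< a *g w >> : P) = << c * a *g w >>.
  by apply/malgP => v; rewrite mcoeffZ !mcoeffU mulrnAr.
rewrite (malgMEw (fsubset_refl _) (msuppZ_le c g)) malgME scaler_sumr.
apply: eq_bigr => w _; rewrite scaler_sumr; apply: eq_bigr => v _.
by rewrite Z mcoeffZ mulrCA.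
Qed.

Lemma freealg_ind (Q : P -> Prop) :
  Q 1 -> (forall x f, Q f -> Q (X x * f)) ->
  (forall (c : F) f g, Q f -> Q g -> Q (c *: f + g)) -> forall f, Q f.
Proof.
move=> Q1 QX Qlin f.
have Q0 : Q 0 by have := Qlin (-1) 1 1 Q1 Q1; rewrite scaleN1r addNr.
rewrite [f]malg_sum; elim: (enum_fset (msupp f)) => [|w r IH].
  by rewrite big_nil.
rewrite big_cons; apply: Qlin => //; case: w => s.
elim: s => [|x s IHs]; first by rewrite malg_nil.
by rewrite malg_word; apply: QX.
Qed.

Lemma mcoeff_gX x : (X x)@_mone = 0 :> F.
Proof. by rewrite mcoeffU fm1_eq1. Qed.

Lemma nonunitalX x : X x \in NU.
Proof. by rewrite inE mcoeff_gX. Qed.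

Lemma nonunital0 : 0 \in NU.
Proof. by rewrite inE mcoeff0. Qed.

Lemma nonunitalZD (c : F) f g : f \in NU -> g \in NU ->
  c *: f + g \in NU.
Proof.
by rewrite !inE mcoeffD mcoeffZ => /eqP-> /eqP->; rewrite mulr0 addr0.
Qed.

Lemma nonunitalMl f g : f \in NU -> f * g \in NU.
Proof. by rewrite !inE rmorphM /= => /eqP->; rewrite mul0r. Qed.

Lemma nonunitalMr f g : g \in NU -> f * g \in NU.
Proof. by rewrite !inE rmorphM /= => /eqP->; rewrite mulr0. Qed.

Lemma unital_decomp f : exists2 f', f' \in NU & f = (f@_mone)%:A + f'.
Proof.
exists (f - (f@_mone)%:A); last by rewrite addrC subrK.
by rewrite inE mcoeffB mcoeffZ mcoeff1 eqxx mulr1 subrr.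
Qed.

(** Words are built from single letters, never from 1, because graded endomorphisms are constrained
    only on [nonunital]. *)
Lemma nonunital_ind (Q : P -> Prop) : Q 0 -> (forall x, Q (X x)) ->
  (forall x f, f \in NU -> Q f -> Q (X x * f)) ->
  (forall (c : F) f g, f \in NU -> g \in NU ->
     Q f -> Q g -> Q (c *: f + g)) ->
  forall f, f \in NU -> Q f.
Proof.
move=> Q0 QX QXM Qlin f Nf.
suff : f \in NU /\ Q f by case.
rewrite [f]malg_sum; have : forall w, w \in enum_fset (msupp f) -> w != mone.
  move=> w; rewrite -/(w \in msupp f) -mcoeff_neq0; apply: contraNneq => ->.
  exact: Nf.
elim: (enum_fset (msupp f)) => [|w r IH] wr.
  by rewrite big_nil; split; rewrite ?nonunital0.
have [|Nr Qr] := IH; first by move=> v vr; rewrite wr // inE vr orbT.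
have : w != mone by rewrite wr // inE eqxx.
have NQw : w != mone -> (<< w >> : P) \in NU /\ Q << w >>.
  case: w {wr} => s s1; split; first by rewrite inE mcoeffU (negPf s1).
  elim: s s1 => [|x s IHs] s1; first by case/eqP: s1; apply/val_inj; rewrite /= fm1.
  rewrite malg_word; case: s IHs {s1} => [|y s] IHs.
    by rewrite malg_nil mulr1; apply: QX.
  have ys1 : FMonom (y :: s) != mone by rewrite -val_eqE /= fm1.
  apply: QXM; last exact: IHs.
  by rewrite inE mcoeffU (negPf ys1).
rewrite big_cons => /NQw[Nw Qw]; split; first exact: nonunitalZD.
exact: Qlin.
Qed.


Lemma wdegM (w v : {fmonom (gvar G)}) : wdeg (mmul w v) = wdeg w + wdeg v.
Proof. by rewrite /wdeg fmM big_cat. Qed.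

Lemma homogP g f : reflect (f \in NU /\ forall w, f@_w != 0 -> wdeg w = g)
  (f \in homog g).
Proof.
apply: (iffP andP) => -[Nf deg]; split=> //.
  by move=> w; rewrite mcoeff_neq0 => /(allP deg)/eqP.
by apply/allP => w; rewrite -mcoeff_neq0 => /deg/eqP.
Qed.

Lemma homog_nonunital g f : f \in homog g -> f \in NU.
Proof. by case/homogP. Qed.

Lemma homog0 g : (0 : P) \in homog g.
Proof.
by apply/homogP; split=> [|w]; rewrite ?nonunital0 // mcoeff0 eqxx.
Qed.

Lemma homogZD g (c : F) f h : f \in homog g -> h \in homog g ->
  c *: f + h \in homog g.
Proof.
move=> /homogP[Nf df] /homogP[Nh dh]; apply/homogP; split; first exact: nonunitalZD.
move=> w; have [fw|/df//] := eqVneq (f@_w) 0.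
by rewrite mcoeffD mcoeffZ fw mulr0 add0r => /dh.
Qed.

Lemma homogM g g' f h : f \in homog g -> h \in homog g' -> f * h \in homog (g + g').
Proof.
move=> /homogP[Nf df] /homogP[Nh dh]; apply/homogP; split; first exact: nonunitalMl.
move=> w; rewrite mcoeff_neq0 => /msuppM_le[w1 [w2 [/= + + ->]]].
by rewrite -!mcoeff_neq0 wdegM => /df -> /dh ->.
Qed.

Lemma homogX x : X x \in homog x.2.
Proof.
apply/homogP; split=> [|w]; first exact: nonunitalX.
rewrite mcoeffU; case: (_ =P w) => [<- _|_]; last by rewrite eqxx.
by rewrite /wdeg fmU big_seq1.
Qed.

Section Substitution.
Variables (S : lalgType F) (a : gvar G -> S).
Hypothesis scaleSr : forall (c : F) (x y : S), c *: (x * y) = x * (c *: y).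

Definition wprod (w : {fmonom (gvar G)}) : S :=
  \prod_(x <- (w : seq (gvar G))) a x.

Fact wprod_mmorphism : mmorphism wprod.
Proof.
by split=> [w v|]; rewrite /wprod ?fmM ?big_cat // fm1 big_nil.
Qed.
HB.instance Definition _ := isMultiplicative.Build _ S wprod wprod_mmorphism.

(** The target is a mere [lalgType], so that this covers both evaluation in [A] and endomorphisms of
    the free algebra. *)
Definition subst f : S := mmap (in_alg S) wprod f.

Lemma substD : {morph subst : f h / f + h}.
Proof. exact: mmapD. Qed.

Lemma substZ (c : F) f : subst (c *: f) = c *: subst f.
Proof. by rewrite /subst mmapZ /= mulr_algl. Qed.

Lemma subst0 : subst 0 = 0.
Proof. exact: mmap0. Qed.

Lemma subst1 : subst 1 = 1.
Proof. exact: mmap1. Qed.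

Lemma substB : {morph subst : f h / f - h}.
Proof. exact: mmapB. Qed.

Lemma substM : {morph subst : f h / f * h}.
Proof.
move=> f h; apply: (commr_mmap_is_multiplicative _).1 => g w v /=.
by rewrite /GRing.comm -scaleSr mulr1 mulr_algl.
Qed.

Lemma substXn f n : subst (f ^+ n) = subst f ^+ n.
Proof.
by elim: n => [|n IH]; rewrite ?expr0 ?subst1 // !exprS substM IH.
Qed.

Lemma substX x : subst (X x) = a x.
Proof.
by rewrite /subst mmapU /= scale1r mul1r /wprod fmU big_seq1; case: x.
Qed.

(** Homogeneous elements involve only non-empty words, so 1 need not lie in [D 0]. *)
Lemma subst_homog (D : G -> S -> Prop) :
  (forall g, D g 0) ->
  (forall g (c : F) u v, D g u -> D g v -> D g (c *: u + v)) ->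
  (forall g g' u v, D g u -> D g' v -> D (g + g') (u * v)) ->
  (forall x, D x.2 (a x)) ->
  forall g f, f \in homog g -> D g (subst f).
Proof.
move=> D0 Dlin DM Da g f /homogP[Nf df]; rewrite /subst mmapE big_seq.
apply: (big_ind (D g)) => // [u v Du Dv|w].
  by rewrite -[u]scale1r; apply: Dlin.
rewrite -mcoeff_neq0 => fw; rewrite -(df w fw) /= mulr_algl -[_ *: _]addr0.
apply: Dlin => //; have : w != mone by apply: contraNneq fw => ->.
case: w {fw} => s; rewrite /wprod /wdeg /=.
elim: s => [|x s IHs] s1; first by case/eqP: s1; apply/val_inj; rewrite /= fm1.
case: s IHs {s1} => [|y s] IHs; first by rewrite !big_seq1.
by rewrite !(big_cons _ _ x); apply/DM/IHs => //; rewrite -val_eqE /= fm1.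
Qed.

Lemma nonunital_morph_subst (phi : P -> S) :
  (forall x, phi (X x) = a x) ->
  (forall (c : F) f h, f \in NU -> h \in NU -> phi (c *: f + h) = c *: phi f + phi h) ->
  (forall f h, f \in NU -> h \in NU -> phi (f * h) = phi f * phi h) ->
  forall f, f \in NU -> phi f = subst f.
Proof.
move=> phiX philin phiM; apply: nonunital_ind => [|x|x f Nf IH|c f h Nf Nh IHf IHh].
- have := philin (-1) 0 0 nonunital0 nonunital0.
  by rewrite scaler0 addr0 scaleN1r addNr subst0.
- by rewrite phiX substX.
- by rewrite phiM ?nonunitalX // substM phiX substX IH.
by rewrite philin // substD substZ IHf IHh.
Qed.

End Substitution.

(** A relation compatible with the operations propagates from letters to polynomials; this serves to
    compare values in the matrices and in the quotient. *)
Lemma subst_rel (S S' : lalgType F) (a : gvar G -> S) (a' : gvar G -> S')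
    (rel : S -> S' -> Prop) :
  (forall (c : F) (x y : S), c *: (x * y) = x * (c *: y)) ->
  (forall (c : F) (x y : S'), c *: (x * y) = x * (c *: y)) ->
  rel 1 1 ->
  (forall (c : F) u v u' v', rel u u' -> rel v v' -> rel (c *: u + v) (c *: u' + v')) ->
  (forall u v u' v', rel u u' -> rel v v' -> rel (u * v) (u' * v')) ->
  (forall x, rel (a x) (a' x)) -> forall f, rel (subst a f) (subst a' f).
Proof.
move=> Sr Sr' rel1 rellin relM rela; apply: freealg_ind => [|x f IH|c f g IHf IHg].
- by rewrite !subst1.
- by rewrite !substM // !substX; apply: relM.
by rewrite !substD !substZ; apply: rellin.
Qed.

Lemma gevalE (A : algType F) (a : gvar G -> A) f : geval a f = subst a f.
Proof. by []. Qed.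

Lemma graded_endo_subst (a : gvar G -> P) :
  (forall x, a x \in homog x.2) -> graded_endo (subst a).
Proof.
move=> ha; split=> [c f1 f2 _ _|f1 f2 _ _|].
- by rewrite substD substZ.
- by rewrite substM //; apply: malg_scaleAr.
apply: (subst_homog (D := fun g f => f \in homog g)) => //.
- exact: homog0.
- exact: homogZD.
- exact: homogM.
Qed.

End FreeAlgebra.

(** * Splitting into constant, even and odd parts *)

Section Parity.
Variable F : fieldType.
Local Notation P := (freealg F 'Z_2).

Lemma parity_decomp (f : P) : exists (c : F) (f0 f1 : P),
  [/\ f0 \in homog 0, f1 \in homog 1 & f = c%:A + f0 + f1].
Proof.
elim/freealg_ind: f => [|x f [c [f0 [f1 [h0 h1 ->]]]]|].
- by exists 1, 0, 0; rewrite !homog0 scale1r !addr0.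
- have x01 : x.2 = 0 \/ x.2 = 1.
    by case: (x.2) => -[|[|m]] // lt; [left|right]; apply/val_inj.
  have hX := homogX F x.
  have hXc : c *: gX F x.1 x.2 \in homog x.2.
    by rewrite -[_ *: _]addr0; apply: homogZD => //; apply: homog0.
  have H0 := homogM hX h0; have H1 := homogM hX h1; rewrite addr0 in H0.
  have hD : c *: gX F x.1 x.2 + gX F x.1 x.2 * f0 \in homog x.2.
    by rewrite -[c *: _]scale1r; apply: homogZD.
  have E : gX F x.1 x.2 * (c%:A + f0 + f1) =
      c *: gX F x.1 x.2 + gX F x.1 x.2 * f0 + gX F x.1 x.2 * f1.
    by rewrite !mulrDr -malg_scaleAr mulr1.
  case: x01 => ex; rewrite ex in E H1 hD.
    rewrite (add0r (1 : 'Z_2)) in H1; rewrite ex E.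
    eexists 0, _, _; split; [exact: hD|exact: H1|].
    by rewrite scale0r add0r.
  have e11 : 1 + 1 = 0 :> 'Z_2 by apply/val_inj.
  rewrite e11 in H1; rewrite ex E.
  eexists 0, _, _; split; [exact: H1|exact: hD|].
  by rewrite scale0r add0r addrC.
move=> d f g [c [f0 [f1 [h0 h1 ->]]]] [c' [g0 [g1 [k0 k1 ->]]]].
exists (d * c + c'), (d *: f0 + g0), (d *: f1 + g1).
split; try exact: homogZD.
rewrite !scalerDr scalerA scalerDl.
move: (_%:A) (_%:A) (d *: f0) (d *: f1) => u v u0 u1; clear.
have AC (V : zmodType) (x y z x' y' z' : V) :
    x + y + z + (x' + y' + z') = x + x' + (y + y') + (z + z').
  by rewrite addrACA; congr (_ + _); rewrite addrACA.
exact: AC.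
Qed.

End Parity.

(** * Two-by-two matrices by entries *)

Section TwoByTwo.
Variable F : comNzRingType.

Lemma mx2P (M N : 'M[F]_2) : M 0 0 = N 0 0 -> M 0 1 = N 0 1 ->
  M 1 0 = N 1 0 -> M 1 1 = N 1 1 -> M = N.
Proof.
move=> e00 e01 e10 e11; apply/matrixP => i j.
have two (k : 'I_2) : k = 0 \/ k = 1.
  by case: k => -[|[|k]] // lt; [left|right]; apply/val_inj.
by have [->|->] := two i; have [->|->] := two j.
Qed.

Lemma mx2_surj (M : 'M[F]_2) : exists a b c d, M = mx2 a b c d.
Proof.
by exists (M 0 0), (M 0 1), (M 1 0), (M 1 1); apply: mx2P; rewrite mxE.
Qed.

Lemma mx2_inj (a b c d a' b' c' d' : F) :
  mx2 a b c d = mx2 a' b' c' d' -> [/\ a = a', b = b', c = c' & d = d'].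
Proof.
move/matrixP => E; split.
- by have := E 0 0; rewrite !mxE.
- by have := E 0 1; rewrite !mxE.
- by have := E 1 0; rewrite !mxE.
- by have := E 1 1; rewrite !mxE.
Qed.

Lemma mx2D (a b c d a' b' c' d' : F) :
  mx2 a b c d + mx2 a' b' c' d' = mx2 (a + a') (b + b') (c + c') (d + d').
Proof. by apply: mx2P; rewrite !mxE. Qed.

Lemma mx2Z (s a b c d : F) : s *: mx2 a b c d = mx2 (s * a) (s * b) (s * c) (s * d).
Proof. by apply: mx2P; rewrite !mxE. Qed.

Lemma mx2M (a b c d a' b' c' d' : F) : mx2 a b c d * mx2 a' b' c' d' =
  mx2 (a * a' + b * c') (a * b' + b * d') (c * a' + d * c') (c * b' + d * d').
Proof.
by apply: mx2P; rewrite !mxE !big_ord_recl big_ord0 !mxE /= addr0.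
Qed.

Lemma mx2_scalar (s : F) : s%:A = mx2 s 0 0 s.
Proof. by apply: mx2P; rewrite !mxE ?mulr1 ?mulr0. Qed.

Lemma mx2_1 : 1 = mx2 1 0 0 1 :> 'M[F]_2.
Proof. by rewrite -mx2_scalar scale1r. Qed.

Lemma mx2_0 : 0 = mx2 0 0 0 0 :> 'M[F]_2.
Proof. by apply: mx2P; rewrite !mxE. Qed.

Definition mx2E := (mx2_scalar, mx2_1, mx2Z, mx2D, mx2M).

End TwoByTwo.

(** * The grading of the matrix algebra and matrix forms of the four identities *)

Section Dtilde.
Variables (F : finFieldType) (q : nat) (b : F).
Hypotheses (char2 : 2%N \in [pchar F]) (cardF : #|F| = q).
Hypothesis hb : forall x : F, b <> x ^+ 2 + x.

(** Reduces an equality in characteristic 2 to one that [ring] proves in any commutative ring; [k]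
    is half of the sum of both sides. *)
Lemma char2_eq (x y k : F) : x + y = k + k -> x = y.
Proof.
by rewrite addrr_pchar2 // => /eqP; rewrite addr_eq0 oppr_pchar2 // => /eqP.
Qed.

(** [thetamx] and [taumx] realise [t] and [j]: the even part is [F[thetamx]], and the odd part is
    its multiple by [taumx]. *)
Definition thetamx : 'M[F]_2 := mx2 0 1 b 1.
Definition taumx : 'M[F]_2 := mx2 1 0 1 1.

Lemma thetamx_sqr : thetamx * thetamx = thetamx + b%:A.
Proof.
by rewrite /thetamx !mx2E; congr mx2; ring.
Qed.

Lemma taumx_sqr : taumx * taumx = 1.
Proof.
by rewrite /taumx !mx2E; congr mx2; try ring; apply: (char2_eq (k := 1)); ring.
Qed.

Lemma taumx_thetamx : taumx * thetamx = (thetamx + 1) * taumx.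
Proof.
rewrite /taumx /thetamx !mx2E; congr mx2; try ring.
  by apply: (char2_eq (k := 1)); ring.
by apply: (char2_eq (k := b + 1)); ring.
Qed.

Lemma Dtilde0P M : reflect (exists k, M = qeval thetamx k) (M \in Dtilde b 0).
Proof.
have E u w : u%:A + w *: thetamx = mx2 u w (b * w) (u + w).
  by rewrite /thetamx !mx2E; congr mx2; ring.
rewrite inE; apply: (iffP existsP) => [[u /existsP[v /eqP->]]|[[u w] ->]].
  exists (u, u + v); rewrite /qeval E /=; congr mx2.
  by apply: (char2_eq (k := u + v)); ring.
exists u; apply/existsP; exists (u + w); apply/eqP; rewrite /qeval E /=.
by congr mx2; [apply: (char2_eq (k := u + w))|apply: (char2_eq (k := b * (u + w)))]; ring.
Qed.

Lemma Dtilde1P M : reflect (exists l, M = qeval thetamx l * taumx) (M \in Dtilde b 1).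
Proof.
have E u w : (u%:A + w *: thetamx) * taumx = mx2 (u + w) w (b * w + u + w) (u + w).
  by rewrite /thetamx /taumx !mx2E; congr mx2; ring.
rewrite inE; apply: (iffP existsP) => [[u /existsP[v /eqP->]]|[[u w] ->]].
  (* The upper right entry is the coefficient of [thetamx * taumx]; the diagonal entry then gives
     the other one. *)
  exists (b * u + v + u, u); rewrite /qeval E /=; congr mx2.
  - by apply: (char2_eq (k := b * u + v + u)); ring.
  - by apply: (char2_eq (k := b * u + v + u)); ring.
  by apply: (char2_eq (k := b * u + v + u)); ring.
exists w; apply/existsP; exists (b * w + u + w); apply/eqP; rewrite /qeval E /=.
by congr mx2; apply: (char2_eq (k := b * w + u + w)); ring.
Qed.


Let theta_okM k l : qeval thetamx (qmul b k l) = qeval thetamx k * qeval thetamx l.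
Proof. by apply: (qevalM (okt := true)) => // _; exact: thetamx_sqr. Qed.

Let tau_okC k : taumx * qeval thetamx k = qeval thetamx (qconj k) * taumx.
Proof.
by apply: (qconjP (okt := true) (okj := true)) => // _ _; exact: taumx_thetamx.
Qed.

Lemma Z2_cases (g : 'Z_2) : g = 0 \/ g = 1.
Proof. by case: g => -[|[|g]] // lt; [left|right]; apply/val_inj. Qed.

Lemma Dtilde_0 g : 0 \in Dtilde b g.
Proof.
have [->|->] := Z2_cases g.
  by apply/Dtilde0P; exists 0; rewrite qeval0.
by apply/Dtilde1P; exists 0; rewrite qeval0 mul0r.
Qed.

Lemma Dtilde_ZD g (c : F) M N : M \in Dtilde b g -> N \in Dtilde b g ->
  c *: M + N \in Dtilde b g.
Proof.
have [->|->] := Z2_cases g.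
  move=> /Dtilde0P[k ->] /Dtilde0P[l ->]; apply/Dtilde0P.
  by exists (qscale c k + l); rewrite qevalD qevalZ.
move=> /Dtilde1P[k ->] /Dtilde1P[l ->]; apply/Dtilde1P.
by exists (qscale c k + l); rewrite qevalD qevalZ scalerAl -mulrDl.
Qed.

Lemma Dtilde_M g h M N : M \in Dtilde b g -> N \in Dtilde b h ->
  M * N \in Dtilde b (g + h).
Proof.
have [->|->] := Z2_cases g; have [->|->] := Z2_cases h.
- move=> /Dtilde0P[k ->] /Dtilde0P[l ->]; rewrite addr0; apply/Dtilde0P.
  by exists (qmul b k l); rewrite theta_okM.
- move=> /Dtilde0P[k ->] /Dtilde1P[l ->]; rewrite add0r; apply/Dtilde1P.
  by exists (qmul b k l); rewrite theta_okM mulrA.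
- move=> /Dtilde1P[k ->] /Dtilde0P[l ->]; rewrite addr0; apply/Dtilde1P.
  by exists (qmul b k (qconj l)); rewrite theta_okM -!mulrA tau_okC.
have -> : 1 + 1 = 0 :> 'Z_2 by apply/val_inj.
move=> /Dtilde1P[k ->] /Dtilde1P[l ->]; apply/Dtilde0P.
exists (qmul b k (qconj l)); rewrite theta_okM -mulrA [taumx * _]mulrA tau_okC.
by rewrite -[_ * taumx * taumx]mulrA taumx_sqr mulr1.
Qed.

Lemma Dtilde0_frobenius k : qeval thetamx k ^+ q = qeval thetamx (qconj k).
Proof.
rewrite /qeval /= (quadratic_frobenius char2 cardF hb) //; exact: thetamx_sqr.
Qed.

Lemma Dtilde0_pow M : M \in Dtilde b 0 -> M ^+ (q ^ 2) = M.
Proof.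
move=> /Dtilde0P[k ->]; rewrite -mulnn exprM !Dtilde0_frobenius.
congr (qeval _ _); case: k => u w; rewrite /qconj /=; congr (_, _).
by apply: (char2_eq (k := u + w)); ring.
Qed.

Lemma Dtilde_twist M N : M \in Dtilde b 1 -> N \in Dtilde b 0 -> M * N = N ^+ q * M.
Proof.
move=> /Dtilde1P[l ->] /Dtilde0P[k ->]; rewrite Dtilde0_frobenius.
rewrite -mulrA tau_okC !mulrA -!theta_okM; congr (qeval _ _ * _).
by rewrite /qmul; congr (_, _); ring.
Qed.

(** An odd matrix squares to the scalar [s], a norm from [F[thetamx]]. The norm form is anisotropic
    by the choice of [b], so either the matrix is 0 or [s ^+ (q ^ 2 - 1) = 1]. *)
Lemma Dtilde1_pow M : M \in Dtilde b 1 -> M ^+ (2 * q ^ 2 - 1) = M.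
Proof.
move=> /Dtilde1P[[u w] ->]; set z := _ * taumx.
pose s := u * (u + w) + b * (w * w).
have zz : z * z = s%:A.
  rewrite /z -mulrA [taumx * _]mulrA tau_okC -[_ * taumx * taumx]mulrA taumx_sqr mulr1.
  rewrite -theta_okM /qeval /qmul /= [X in _ + X *: _](_ : _ = 0).
    by rewrite scale0r addr0.
  by apply: (char2_eq (k := u * w + w * w)); ring.
have q_gt1 : (1 < q)%N by rewrite -cardF finNzRing_gt1.
have -> : (2 * q ^ 2 - 1 = 2 * (q ^ 2 - 1) + 1)%N by nia.
rewrite exprD expr1 exprM expr2 zz scalar_pow; have [s0|s0] := eqVneq s 0.
  suff -> : z = 0 by rewrite mulr0.
  have w0 : w = 0.
    apply/eqP; apply: contraT => w0; case: (hb (x := u / w)).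
    have : (u / w) ^+ 2 + u / w = b + s / (w ^+ 2).
      by apply: (char2_eq (k := b + (u / w) ^+ 2 + u / w)); rewrite /s; field.
    by rewrite s0 mul0r addr0.
  have u0 : u = 0.
    by apply/eqP; move/eqP: s0; rewrite /s w0 mulr0 mulr0 !addr0 mulf_eq0 orbb.
  by rewrite /z u0 w0 /qeval !scale0r addr0 mul0r.
have -> : s ^+ (q ^ 2 - 1) = 1.
  apply: (mulIf s0); rewrite -exprSr -subSn ?expn_gt0 ?(ltnW q_gt1) // subn1 /=.
  by rewrite mul1r -mulnn exprM -cardF !expf_card.
by rewrite scale1r mul1r.
Qed.

Lemma mx2_Cayley (a c d e : F) : let M := mx2 a c d e in
  M * M = (a + e) *: M + (a * e + c * d)%:A.
Proof.
rewrite /= !mx2E; congr mx2; try ring.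
  by apply: (char2_eq (k := a * a + a * e + c * d)); ring.
by apply: (char2_eq (k := e * e + a * e + c * d)); ring.
Qed.

(** With trace 0, [M] is a scalar plus an element of square zero, which the [q]-th power kills. With
    trace [t] non-zero, [t^-1 *: M] satisfies an Artin-Schreier equation, so Frobenius shifts it by
    a scalar, and doing so twice cancels. *)
Lemma mx2_pow_decomp (M : 'M[F]_2) : M ^+ (q ^ 2) = M \/
  exists m (s : F), [/\ M = m + s%:A, m * m = 0 & M ^+ (q ^ 2) = s%:A].
Proof.
have [a [c [d [e ->]]]] := mx2_surj M.
have := mx2_Cayley a c d e; set t := a + e; set n := _ + _; set B := mx2 _ _ _ _.
have [-> /= BB|t0 /= BB] := eqVneq t 0.
  right; rewrite scale0r add0r in BB.
  have [k k0 qk] := card_pow2 char2 cardF; pose s := n ^+ (2 ^ k.-1).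
  have ss : s ^+ 2 = n.
    by rewrite -exprM -expnSr prednK // -qk -cardF expf_card.
  exists (B + s%:A), s.
  have mm : (B + s%:A) * (B + s%:A) = 0.
    rewrite -expr2 (exprD2k 1 (alg_pchar2 _ char2)) ?expn1.
      by rewrite scalar_pow ss expr2 BB (alg_addxx char2).
    exact/commr_sym/scalar_comm.
  have BE : B = B + s%:A + s%:A by rewrite -addrA (alg_addxx char2) addr0.
  split=> //; rewrite {1}BE -mulnn exprM (exprDq char2 cardF); last first.
    exact/commr_sym/scalar_comm.
  have -> : (B + s%:A) ^+ q = 0.
    by rewrite qk -(prednK k0) expnS exprM expr2 mm expr0n expn_eq0.
  by rewrite add0r !scalar_pow -cardF !expf_card.
left; pose w := t^-1 *: B.
have BE : B = t *: w by rewrite scalerA divff // scale1r.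
have ww : w * w = w + (t^-1 * t^-1 * n)%:A.
  rewrite /w -scalerAl -scalerAr BB !scalerDr !scalerA; congr (_ *: _ + _).
  by rewrite -mulrA mulVf // mulr1.
clearbody w; have [c' wq] := artin_schreier_shift char2 cardF ww.
rewrite BE -mulnn exprM !(exprZq cardF) wq (exprDq char2 cardF); last first.
  exact/commr_sym/scalar_comm.
by rewrite scalar_pow -[in c' ^+ _]cardF expf_card wq -addrA (alg_addxx char2) addr0.
Qed.

Lemma mx2_nilpotent (m : 'M[F]_2) : m * m = 0 ->
  exists p r s, m = mx2 p r s p /\ r * s = p * p.
Proof.
have [p [r [s [p' ->]]]] := mx2_surj m.
rewrite mx2_0 mx2M => /mx2_inj[e1 _ _ e4]; exists p, r, s.
have : (p' + p) ^+ 2 = (p * p + r * s) + (s * r + p' * p').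
  by apply: (char2_eq (k := p * p + p' * p' + p * p' + r * s)); ring.
rewrite e1 e4 addr0 => /eqP; rewrite sqrf_eq0 addr_eq0 oppr_pchar2 // => /eqP ->.
by split=> //; move/eqP: e1; rewrite addr_eq0 oppr_pchar2 // => /eqP.
Qed.

(** As [m] has rank at most one, the factor is the trace of [A * m]. *)
Lemma mx2_sandwich (A m : 'M[F]_2) : m * m = 0 -> exists t : F, m * A * m = t *: m.
Proof.
move=> /mx2_nilpotent[p [r [s [-> rs]]]]; have [a [c [d [e ->]]]] := mx2_surj A.
exists (a * p + c * s + d * r + e * p); rewrite mx2Z !mx2M.
congr mx2.
- transitivity (p * a * p + r * d * p + p * c * s + e * (r * s)); first by ring.
  by rewrite rs; ring.
- transitivity (p * a * r + d * r * r + c * (p * p) + e * p * r); first by ring.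
  by rewrite -rs; ring.
- transitivity (s * a * p + d * (p * p) + s * c * s + p * e * s); first by ring.
  by rewrite -rs; ring.
transitivity (a * (r * s) + p * d * r + s * c * p + p * e * p); first by ring.
by rewrite rs; ring.
Qed.

(** For non-zero [m], kernel and image are the same line; [m * A * m = 0] says that [A] preserves
    it, and [l] is the eigenvalue there. *)
Lemma mx2_eigen (A m : 'M[F]_2) : m * m = 0 -> m * A * m = 0 ->
  exists l : F, A * m = l *: m.
Proof.
move=> /mx2_nilpotent[p [r [s [-> rs]]]]; have [a [c [d [e ->]]]] := mx2_surj A.
rewrite mx2_0 !mx2M => /mx2_inj[_ h2 h3 _].
have [r0|r0] := eqVneq r 0.
  have p0 : p = 0 by apply/eqP; move/eqP: rs; rewrite r0 mul0r eq_sym mulf_eq0 orbb.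
  exists e; rewrite mx2Z r0 p0.
  have cs : c * s = 0.
    apply/eqP; move/eqP: h3; rewrite p0 !(mul0r, mulr0, addr0, add0r).
    by rewrite !mulf_eq0 orbC => /orP[->|/orP[]->]; rewrite ?orbT.
  by congr mx2; rewrite ?cs; ring.
have trace0 : d * r + e * p = a * p + c * s.
  apply: (mulfI r0).
  transitivity (((p * a + r * d) * r + (p * c + r * e) * p) + (p * a * r + c * (p * p))).
    by apply: (char2_eq (k := r * d * r + r * e * p + p * a * r + c * p * p)); ring.
  by rewrite h2 -rs; ring.
pose l := (a * r + c * p) / r; have lr : l * r = a * r + c * p by rewrite divfK.
have lp : a * p + c * s = l * p.
  apply: (mulIf r0); rewrite mulrAC lr.
  transitivity (a * p * r + c * (r * s)); first by ring.
  by rewrite rs; ring.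
exists l; rewrite mx2Z; congr mx2 => //; last by rewrite trace0.
apply: (mulIf r0); transitivity (p * (d * r + e * p)).
  transitivity (d * p * r + e * (r * s)); first by ring.
  by rewrite rs; ring.
rewrite trace0 lp; transitivity (l * (p * p)); first by ring.
by rewrite -rs; ring.
Qed.

(** The middle factor is 0 or a square-zero [m] with [m * comm A B = t *: m]. If [t] is non-zero,
    the last factor kills [m] because [t ^+ (q - 1) = 1]; otherwise [A * m = l *: m], and the first
    factor kills [m] because [l ^+ q = l]. *)
Lemma mx2_gen4 (A B : 'M[F]_2) :
  (A - A ^+ q) * (B - B ^+ (q ^ 2)) * (1 - comm A B ^+ (q - 1)) = 0.
Proof.
have q_gt1 : (1 < q)%N by rewrite -cardF finNzRing_gt1.
have [->|[m [s [Bm mm ->]]]] := mx2_pow_decomp B.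
  by rewrite subrr mulr0 mul0r.
have -> : B - s%:A = m by rewrite Bm addrK.
have cE : m * comm A B = m * A * m.
  have -> : comm A B = A * m - m * A.
    by rewrite /comm Bm mulrDr mulrDl opprD addrACA -scalar_comm subrr addr0.
  by rewrite mulrBr !mulrA mm mul0r subr0.
have [t mAm] := mx2_sandwich A mm.
have mcX n : m * comm A B ^+ n = t ^+ n *: m.
  elim: n => [|n IH]; first by rewrite !expr0 mulr1 scale1r.
  by rewrite exprS mulrA cE mAm -scalerAl IH scalerA exprS.
have [t0|t0] := eqVneq t 0; last first.
  rewrite -mulrA mulrBr mulr1 mcX.
  have -> : t ^+ (q - 1) = 1.
    apply: (mulIf t0); rewrite -exprSr -subSn ?(ltnW q_gt1) // subn1 /=.
    by rewrite mul1r -cardF expf_card.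
  by rewrite scale1r subrr mulr0.
have [l Al] : exists l : F, A * m = l *: m.
  by apply: mx2_eigen; rewrite // mAm t0 scale0r.
have AX n : A ^+ n * m = l ^+ n *: m.
  elim: n => [|n IH]; first by rewrite !expr0 mul1r scale1r.
  by rewrite exprSr -mulrA Al -scalerAr IH scalerA exprS.
by rewrite mulrBl AX -cardF expf_card Al subrr mul0r.
Qed.


(** Linear independence of [1, t, j, tj] in the matrices: each coordinate is a combination of the
    entries. *)
Lemma ceval_mx_eq0 c : ceval thetamx taumx c = 0 -> c = 0.
Proof.
case: c => -[u v] [s w]; rewrite /ceval /qeval /= /thetamx /taumx mx2_0 !mx2E.
move=> /mx2_inj[]; set x1 := (X in X = 0) => e1; set x2 := (X in X = 0) => e2.
set x3 := (X in X = 0) => e3; set x4 := (X in X = 0) => e4.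
have -> : v = x4 - x1 by rewrite /x4 /x1; ring.
have -> : w = x2 - (x4 - x1) by rewrite /x4 /x1 /x2; ring.
have -> : s = x3 - b * x2 - (x2 - (x4 - x1)) by rewrite /x1 /x2 /x3 /x4; ring.
have -> : u = x1 - (x3 - b * x2) by rewrite /x1 /x2 /x3; ring.
by rewrite e1 e2 e3 e4 !(mulr0, subr0).
Qed.

End Dtilde.

(** * Ideals maximal among those avoiding an element *)

Lemma maximal_ideal_avoiding (A : nzRingType) (I : A -> Prop) (f : A) :
  two_sided I -> ~ I f ->
  exists J : A -> Prop, [/\ two_sided J, forall x, I x -> J x, ~ J f &
    forall J', two_sided J' -> (forall x, J x -> J' x) -> ~ J' f ->
      forall x, J' x -> J x].
Proof.
(* Adjoining [I] to every set handles the empty chain, whose union is empty but yields the ideal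
   [I]. *)
move=> idI nIf; pose U (J : classical_sets.set A) x := I x \/ J x.
pose cup (C : classical_sets.set (classical_sets.set A)) :=
  classical_sets.bigcup C id.
pose good (J : classical_sets.set A) := two_sided (U J) /\ ~ U J f.
have [|J [[idJ nJf] Jmax]] := @classical_sets.Zorn_bigcup A good.
  move=> C goodC totC.
  have two x y : U (cup C) x -> U (cup C) y ->
      (I x /\ I y) \/ exists2 X, C X & U X x /\ U X y.
    move=> [Ix|[X CX Xx]] [Iy|[Y CY Yy]].
    - by left.
    - by right; exists Y => //; split; [left|right].
    - by right; exists X => //; split; [right|left].
    by right; have [XY|YX] := totC X Y CX CY; [exists Y|exists X] => //;
      split; right; rewrite //; [exact: XY|exact: YX].
  have up X x : C X -> U X x -> U (cup C) x.
    by move=> CX [Ix|Xx]; [left|right; exists X].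
  split; last first.
    by case=> // -[X CX Xf]; case: (goodC X CX) => _; apply; right.
  split.
  - by left; apply: two_sided0.
  - move=> x y Ux Uy; have [[Ix Iy]|[X CX [Xx Xy]]] := two x y Ux Uy.
      by left; apply: two_sidedB.
    by apply: (up X) => //; case: (goodC X CX) => idX _; apply: two_sidedB.
  - move=> x y Uy; have [[_ Iy]|[X CX [_ Xy]]] := two y y Uy Uy.
      by left; apply: two_sidedMl.
    by apply: (up X) => //; case: (goodC X CX) => idX _; apply: two_sidedMl.
  move=> x y Ux; have [[Ix _]|[X CX [Xx _]]] := two x x Ux Ux.
    by left; apply: two_sidedMr.
  by apply: (up X) => //; case: (goodC X CX) => idX _; apply: two_sidedMr.
exists (U J); split=> // [x Ix|J' idJ' JJ' nJ'f x J'x]; first by left.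
apply: contrapT => nUx; apply: (Jmax J').
  by split=> [y Jy|J'J]; [apply: JJ'; right|apply: nUx; right; apply: J'J].
have UJ' y : U J' y <-> J' y.
  by split=> [[Iy|//]|]; [apply: JJ'; left|right].
split; last by move/UJ'.
have -> : U J' = J' by apply/funext => y; apply/propext/UJ'.
exact: idJ'.
Qed.

(** * T-ideals as ideals of the unital free algebra *)

Section NonunitalPowers.
Variables (F : fieldType) (G : zmodType).
Local Notation NU := (@nonunital F G).

Lemma nonunitalB f g : f \in NU -> g \in NU -> f - g \in NU.
Proof. by move=> Nf Ng; rewrite addrC -scaleN1r nonunitalZD. Qed.

Lemma nonunitalXn f n : (0 < n)%N -> f \in NU -> f ^+ n \in NU.
Proof. by case: n => // n _ Nf; rewrite exprS nonunitalMl. Qed.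

(** A general factor is a constant plus a [nonunital] element: linearity handles the first,
    absorption the second. *)
Lemma T_ideal_two_sided (I : freealg F G -> Prop) : T_ideal I -> two_sided I.
Proof.
case=> IN I0 Ilin IMl IMr _; split=> //.
- by move=> x y Ix Iy; rewrite addrC -scaleN1r; apply: Ilin.
- move=> x y Iy; have [x' Nx ->] := unital_decomp x.
  by rewrite mulrDl -scalerAl mul1r; apply: Ilin => //; apply: IMl.
move=> x y Ix; have [y' Ny ->] := unital_decomp y.
by rewrite mulrDr -malg_scaleAr mulr1; apply: Ilin => //; apply: IMr.
Qed.

Lemma graded_endo_nonunital phi f : graded_endo phi -> f \in NU -> phi f \in NU.
Proof.
case=> philin phiM phihom; move: f.
apply: nonunital_ind => [|x|x f Nf Nphi|c f g Nf Ng IHf IHg].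
- exact: homog_nonunital (phihom 0 _ (homog0 _ _)).
- exact: homog_nonunital (phihom _ _ (homogX F x)).
- rewrite phiM ?nonunitalX //; exact: nonunitalMr.
by rewrite philin // nonunitalZD.
Qed.

End NonunitalPowers.

(** * The graded identities form a T-ideal containing the generators *)

Section DtildeIdentities.
Variables (F : finFieldType) (q : nat) (b : F).
Hypotheses (char2 : 2%N \in [pchar F]) (cardF : #|F| = q).
Hypothesis hb : forall x : F, b <> x ^+ 2 + x.
Local Notation P := (freealg F 'Z_2).
Local Notation M2 := 'M[F]_2.

Let scaleM2 (c : F) (x y : M2) : c *: (x * y) = x * (c *: y).
Proof. exact: scalerAr. Qed.

Lemma geval_homog (a : gvar 'Z_2 -> M2) g (f : P) :
  (forall x, a x \in Dtilde b x.2) -> f \in homog g -> geval a f \in Dtilde b g.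
Proof.
move=> ha; apply: (subst_homog (D := fun g M => M \in Dtilde b g)) => //.
- exact: Dtilde_0.
- by move=> h c M N; apply: Dtilde_ZD.
by move=> h h' M N; apply: Dtilde_M.
Qed.

Lemma Dtilde_identities_T_ideal : T_ideal (graded_identity (Dtilde b)).
Proof.
split.
- by move=> f [].
- by split=> [|a _]; rewrite ?nonunital0 // gevalE subst0.
- move=> c f1 f2 [N1 id1] [N2 id2]; split=> [|a ha]; first exact: nonunitalZD.
  rewrite gevalE substD substZ.
  by rewrite (id1 a ha : subst a f1 = 0) (id2 a ha : subst a f2 = 0) scaler0 addr0.
- move=> f1 f2 N1 [N2 id2]; split=> [|a ha]; first exact: nonunitalMr.
  by rewrite gevalE substM // (id2 a ha : subst a f2 = 0) mulr0.
- move=> f1 f2 [N1 id1] N2; split=> [|a ha]; first exact: nonunitalMl.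
  by rewrite gevalE substM // (id1 a ha : subst a f1 = 0) mul0r.
move=> phi f endo [Nf idf]; split=> [|a ha]; first exact: graded_endo_nonunital.
have [philin phiM phihom] := endo.
(* Evaluation at [a] after [phi] is, on [nonunital], the evaluation at the images of the letters,
   which have the right degrees. *)
pose a' (x : gvar 'Z_2) := geval a (phi (gX F x.1 x.2)).
transitivity (subst a' f).
  apply: (nonunital_morph_subst scaleM2 (phi := geval a \o phi)) => //=.
  - by move=> c f1 f2 N1 N2; rewrite philin // gevalE substD substZ.
  by move=> f1 f2 N1 N2; rewrite phiM // gevalE substM.
by apply: idf => x; apply: geval_homog => //; apply/phihom/homogX.
Qed.

Let q_gt1 : (1 < q)%N.
Proof. by rewrite -cardF finNzRing_gt1. Qed.

Let geval_gX (S : lalgType F) (a : gvar 'Z_2 -> S) i g : subst a (gX F i g) = a (i, g).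
Proof. exact: (substX a (i, g)). Qed.

Let gX_nonunital i g : gX F i g \in @nonunital F 'Z_2.
Proof. exact: (nonunitalX F (i, g)). Qed.

Lemma gen1_identity : graded_identity (Dtilde b) (gen1 F q).
Proof.
split=> [|a ha]; first by
  rewrite /gen1 /yvar nonunitalB ?nonunitalXn ?gX_nonunital ?expn_gt0 ?(ltnW q_gt1).
by rewrite gevalE substB substXn // geval_gX (Dtilde0_pow char2 cardF hb) ?subrr.
Qed.

Lemma gen2_identity : graded_identity (Dtilde b) (gen2 F q).
Proof.
split=> [|a ha].
  by rewrite /gen2 /zvar nonunitalB ?nonunitalXn ?gX_nonunital //; have := q_gt1; nia.
by rewrite gevalE substB substXn // geval_gX (Dtilde1_pow char2 cardF hb) ?subrr.
Qed.

Lemma gen3_identity : graded_identity (Dtilde b) (gen3 F q).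
Proof.
split=> [|a ha]; first by
  rewrite /gen3 /zvar /yvar nonunitalB ?nonunitalMl ?nonunitalXn ?gX_nonunital
    ?(ltnW q_gt1).
have E (u v : P) : subst a (u * v - v ^+ q * u) =
    subst a u * subst a v - subst a v ^+ q * subst a u.
  have sM := substM a scaleM2; rewrite [LHS]substB; congr (_ - _); first exact: sM.
  by rewrite [LHS]sM; congr (_ * _); apply: substXn.
have ez : subst a (zvar F 0) = a (0%N, 1) by exact: geval_gX.
have ey : subst a (yvar F 0) = a (0%N, 0) by exact: geval_gX.
rewrite gevalE [LHS]E ez ey; apply/eqP; rewrite subr_eq0; apply/eqP.
exact: (Dtilde_twist char2 cardF hb (ha (0%N, 1)) (ha (0%N, 0))).
Qed.

Lemma gen4_identity : graded_identity (Dtilde b) (gen4 F q).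
Proof.
have NX i : Xvar F i \in @nonunital F 'Z_2.
  by rewrite /Xvar -[zvar F i]scale1r nonunitalZD ?gX_nonunital.
split=> [|a ha].
  by rewrite /gen4 !nonunitalMl // nonunitalB ?nonunitalXn ?(ltnW q_gt1).
have E (u v : P) : subst a ((u - u ^+ q) * (v - v ^+ (q ^ 2)) *
    (1 - comm u v ^+ (q - 1))) =
    (subst a u - subst a u ^+ q) * (subst a v - subst a v ^+ (q ^ 2)) *
    (1 - comm (subst a u) (subst a v) ^+ (q - 1)).
  have sM := substM a scaleM2; have sX w n : subst a (w ^+ n) = subst a w ^+ n.
    exact: substXn.
  rewrite [LHS]sM; congr (_ * _); first rewrite [LHS]sM.
    by congr (_ * _); rewrite [LHS]substB sX.
  rewrite [LHS]substB subst1 sX; congr (_ - _ ^+ _).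
  by rewrite [LHS]substB; congr (_ - _); apply: sM.
by rewrite gevalE E; apply: mx2_gen4.
Qed.

End DtildeIdentities.

(** * The quotient by a maximal ideal and the lifting of its variables *)

Section MaximalQuotient.
Variables (F : finFieldType) (q : nat) (b : F).
Hypotheses (char2 : 2%N \in [pchar F]) (cardF : #|F| = q).
Hypothesis hb : forall x : F, b <> x ^+ 2 + x.
Local Notation P := (freealg F 'Z_2).
Variables (I J : P -> Prop) (f : P).
Hypotheses (TI : T_ideal I) (IJ : forall x, I x -> J x).
Hypothesis nJf : ~ J f.
Hypothesis maxJ : forall J', two_sided J' -> (forall x, J x -> J' x) -> ~ J' f ->
  forall x, J' x -> J x.
Hypotheses (Igen1 : I (gen1 F q)) (Igen2 : I (gen2 F q)) (Igen3 : I (gen3 F q)).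
Variables (R : algType F) (pi : {lrmorphism P -> R}).
Hypotheses (pi_surj : forall r, exists x, pi x = r).
Hypothesis pi_ker : forall x, pi x = 0 <-> J x.

Let q_gt1 : (1 < q)%N.
Proof. by rewrite -cardF finNzRing_gt1. Qed.

Let piZD c x y : pi (c *: x + y) = c *: pi x + pi y.
Proof. exact: linearP. Qed.

Let piM x y : pi (x * y) = pi x * pi y.
Proof. exact: rmorphM. Qed.

Let pi0 : pi 0 = 0.
Proof. exact: raddf0. Qed.

Let piZ c x : pi (c *: x) = c *: pi x.
Proof. by rewrite -[c *: x]addr0 piZD pi0 addr0. Qed.

Let piB x y : pi (x - y) = pi x - pi y.
Proof. exact: raddfB. Qed.

Let piD x y : pi (x + y) = pi x + pi y.
Proof. exact: raddfD. Qed.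

Let pi_eq x y : I (x - y) -> pi x = pi y.
Proof.
by move=> /IJ/pi_ker; rewrite piB => /eqP; rewrite subr_eq0 => /eqP.
Qed.

(** Stability of [I] under graded endomorphisms allows every even letter to be replaced by [y] and
    every odd one by [z]. *)
Let pi_gens (y z : P) : y \in homog 0 -> z \in homog 1 ->
  [/\ pi y ^+ (q ^ 2) = pi y, pi z ^+ (2 * q ^ 2 - 1) = pi z &
      pi z * pi y = pi y ^+ q * pi z].
Proof.
move=> hy hz; pose a (x : gvar 'Z_2) := if x.2 == 0 then y else z.
have ha x : a x \in homog x.2.
  by rewrite /a; have [->|->] := Z2_cases x.2; rewrite ?eqxx.
have Isub g : I g -> I (subst a g) by exact/(T_ideal_endo TI)/graded_endo_subst.
have sM := substM a (@malg_scaleAr F 'Z_2).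
have sX := substXn a (@malg_scaleAr F 'Z_2).
have ey : subst a (yvar F 0) = y by exact: (substX a (0%N, 0)).
have ez : subst a (zvar F 0) = z by exact: (substX a (0%N, 1)).
have E1 : subst a (gen1 F q) = y ^+ (q ^ 2) - y by rewrite [LHS]substB sX ey.
have E2 : subst a (gen2 F q) = z ^+ (2 * q ^ 2 - 1) - z by rewrite [LHS]substB sX ez.
have E3 : subst a (gen3 F q) = z * y - y ^+ q * z.
  rewrite [LHS]substB; congr (_ - _); first by rewrite [LHS]sM ez ey.
  by rewrite [LHS]sM sX ez ey.
split.
- by rewrite -rmorphXn; apply: pi_eq; rewrite -E1; apply: Isub.
- by rewrite -rmorphXn; apply: pi_eq; rewrite -E2; apply: Isub.
rewrite -rmorphXn -!rmorphM; apply: pi_eq; rewrite -E3; exact: Isub.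
Qed.

(** The constants are added by hand, since [homog 0] lies in [nonunital]. *)
Definition even_image : {pred R} :=
  fun r => `[< exists (c : F) (y : P), y \in homog 0 /\ r = c%:A + pi y >].
Definition odd_image (r : R) : Prop := exists2 z : P, z \in homog 1 & r = pi z.

Let evenP r : reflect (exists (c : F) (y : P), y \in homog 0 /\ r = c%:A + pi y)
  (r \in even_image).
Proof. exact: asboolP. Qed.

Fact even_image_subring : subring_closed even_image.
Proof.
split.
- by apply/evenP; exists 1, 0; rewrite homog0 pi0 addr0 scale1r.
- move=> _ _ /evenP[c [y [hy ->]]] /evenP[d [u [hu ->]]]; apply/evenP.
  exists (c - d), (-1 *: u + y); split; first exact: homogZD.
  rewrite piZD scaleN1r scalerBl opprD addrACA.
  by congr (_ + _); rewrite addrC.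
move=> _ _ /evenP[c [y [hy ->]]] /evenP[d [u [hu ->]]]; apply/evenP.
exists (c * d), (c *: u + (d *: y + y * u)); split.
  apply: homogZD => //; apply: homogZD => //.
  by have := homogM hy hu; rewrite addr0.
rewrite !piZD piM mulrDl !mulrDr !mulr_algl mulr_algr scalerA.
by rewrite -!addrA.
Qed.

HB.instance Definition _ :=
  GRing.isSubringClosed.Build R even_image even_image_subring.

Let scalar_even (c : F) : c%:A \in even_image.
Proof. by apply/evenP; exists c, 0; rewrite homog0 pi0 addr0. Qed.

Let frobD (c : F) (r : R) : (c%:A + r) ^+ q = c%:A + r ^+ q.
Proof.
rewrite (exprDq char2 cardF); last exact: scalar_comm.
by rewrite scalar_pow -[in c ^+ _]cardF expf_card.
Qed.

Let even_pow : {in even_image, forall y, y ^+ (q ^ 2) = y}.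
Proof.
move=> _ /evenP[c [y [hy ->]]]; have [yq _ _] := pi_gens hy (homog0 F 1).
by rewrite -mulnn exprM !frobD -exprM mulnn yq.
Qed.

Let odd_twist z y : odd_image z -> y \in even_image -> z * y = y ^+ q * z.
Proof.
move=> [z' hz ->] /evenP[c [y' [hy ->]]]; have [_ _ zy] := pi_gens hy hz.
by rewrite frobD mulrDl mulrDr zy mulr_algl mulr_algr.
Qed.

Let odd_pow z : odd_image z -> z ^+ (2 * q ^ 2 - 1) = z.
Proof. by move=> [z' hz ->]; case: (pi_gens (homog0 F 0) hz). Qed.

Let oddZ (c : F) z : odd_image z -> odd_image (c *: z).
Proof.
move=> [z' hz ->]; exists (c *: z' + 0); first by rewrite homogZD ?homog0.
by rewrite addr0 piZ.
Qed.

Let oddM z z' : odd_image z -> odd_image z' -> z * z' \in even_image.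
Proof.
move=> [u hu ->] [v hv ->]; apply/evenP; exists 0, (u * v).
rewrite scale0r add0r piM; split=> //.
by have := homogM hu hv; congr (_ \in homog _); apply/val_inj.
Qed.

(** The annihilator of a central [e'] is a two-sided ideal, so by maximality it is zero unless [e']
    kills [pi f]. If [e] kills [pi f], then [1 - e] does not, and [e] annihilates it; otherwise
    [1 - e] annihilates [e]. *)
Let central_idempotent (e : R) : e * e = e -> (forall r, e * r = r * e) ->
  e = 0 \/ e = 1.
Proof.
move=> ee eC.
have step (e' : R) : (forall r, e' * r = r * e') -> pi f * e' <> 0 ->
    forall r, r * e' = 0 -> r = 0.
  move=> eC' fe' r re'; have [p pr] := pi_surj r; rewrite -pr; apply/pi_ker.
  apply: (maxJ (J' := fun x => pi x * e' = 0)) => //; last by rewrite pr.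
    split.
    - by rewrite pi0 mul0r.
    - by move=> x y xe ye; rewrite piB mulrBl xe ye subrr.
    - by move=> x y ye; rewrite piM -mulrA ye mulr0.
    by move=> x y xe; rewrite piM -mulrA -eC' mulrA xe mul0r.
  by move=> x /pi_ker->; rewrite mul0r.
have [fe|fe] := pselect (pi f * e = 0); [left|right].
  apply: (step (1 - e)).
  - by move=> r; rewrite mulrBl mulrBr eC mul1r mulr1.
  - by rewrite mulrBr mulr1 fe subr0 => /pi_ker.
  by rewrite mulrBr mulr1 ee subrr.
apply/esym/eqP; rewrite -subr_eq0; apply/eqP/(step e) => //.
by rewrite mulrBl mul1r ee subrr.
Qed.

(** The power [e] is an idempotent with [y * e = y]. Once shown to be central it is 0 or 1, and 0
    would give [y = 0]. *)
Let even_unit : {in even_image, forall y, y != 0 -> y ^+ (q ^ 2 - 1) = 1}.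
Proof.
move=> y Sy y0; set e := y ^+ _; have Se : e \in even_image by rewrite rpredX.
have q2 : (2 <= q ^ 2)%N by have := q_gt1; nia.
have ye : y * e = y by rewrite -exprS -subSn ?(ltnW q2) // subn1 /= even_pow.
have eX n : (0 < n)%N -> e ^+ n = e.
  have ee : e * e = e.
    by rewrite {1 3}/e -(subnK (_ : 1 <= q ^ 2 - 1)%N) ?leq_subRL ?(ltnW q2) //
      addn1 exprSr -mulrA ye.
  by case: n => // n _; elim: n => // n IH; rewrite exprS IH.
have ee : e * e = e by rewrite -expr2 eX.
have sq0 w : w \in even_image -> w * w = 0 -> w = 0.
  by move=> Sw ww; rewrite -(even_pow Sw) -(subnK q2) exprD expr2 ww mulr0.
have eC r : e * r = r * e.
  have [p <-] := pi_surj r; have [c [p0 [p1 [h0 h1 ->]]]] := parity_decomp p.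
  rewrite piD mulrDl mulrDr; congr (_ + _); last first.
    (* Odd [z] satisfy [z * e = e ^+ q * z], and [e ^+ q = e]. *)
    by rewrite (odd_twist (y := e)) ?(eX q (ltnW q_gt1)) //; exists p1.
  have -> : pi (c%:A + p0) = c%:A + pi p0 by rewrite piD piZ rmorph1.
  have : c%:A + pi p0 \in even_image by apply/evenP; exists c, p0.
  (* Both [e * u * (1 - e)] and [(1 - e) * u * e] have square zero, hence vanish by [sq0]. *)
  move: (_ + _) => u Su; transitivity (e * u * e).
    apply/eqP; rewrite -subr_eq0 -{1}[e * u]mulr1 -mulrBr; apply/eqP/sq0.
      by rewrite !rpredM ?rpredB ?rpred1.
    rewrite -mulrA [(1 - e) * _]mulrA [(1 - e) * (e * u)]mulrA mulrBl mul1r ee.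
    by rewrite subrr !mul0r mulr0.
  apply/esym/eqP; rewrite -subr_eq0 -{1}[u]mul1r -!mulrA -mulrBl; apply/eqP/sq0.
    by rewrite !rpredM ?rpredB ?rpred1.
  rewrite -!mulrA [e * ((1 - e) * _)]mulrA mulrBr mulr1 ee subrr.
  by rewrite mul0r !mulr0.
have [e0|//] := central_idempotent ee eC.
by case/eqP: y0; rewrite -ye e0 mulr0.
Qed.

Lemma not_graded_identity : f \in @nonunital F 'Z_2 -> ~ graded_identity (Dtilde b) f.
Proof.
move=> Nf [_ idf].
have [okt [okj [t [j [tt jj jt evE odE]]]]] :=
  coordinates_exist char2 cardF hb scalar_even even_unit oddZ oddM odd_twist odd_pow.
(* Each letter receives coordinates giving both its image in [R] and a matrix of the same degree. *)
have /choice[c cP] : forall x : gvar 'Z_2, exists c,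
    [/\ admissible okt okj c, ceval (thetamx b) (taumx F) c \in Dtilde b x.2 &
        pi (gX F x.1 x.2) = ceval t j c].
  move=> x; have := homogX F x; have [->|->] := Z2_cases x.2 => hx.
    have [|c [ac c2 xc]] := evE (pi (gX F x.1 0)).
      by apply/evenP; exists 0, (gX F x.1 0); rewrite scale0r add0r.
    exists c; split=> //; apply/(Dtilde0P _ char2).
    by exists c.1; rewrite /ceval c2 qeval0 mul0r addr0.
  have [|c [ac c1 xc]] := odE (pi (gX F x.1 1)); first by exists (gX F x.1 1).
  exists c; split=> //; apply/(Dtilde1P _ char2).
  by exists c.2; rewrite /ceval c1 qeval0 add0r.
pose rel (M : 'M[F]_2) (r : R) := exists c, [/\ admissible okt okj c,
  M = ceval (thetamx b) (taumx F) c & r = ceval t j c].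
have relf : rel (subst (fun x => ceval (thetamx b) (taumx F) (c x)) f)
                (subst (fun x => pi (gX F x.1 x.2)) f).
  apply: subst_rel.
  - exact: scalerAr.
  - exact: scalerAr.
  - exists (cone F); rewrite !ceval1; split=> //.
    by rewrite /admissible /= !eqxx !orbT.
  - move=> d u v u' v' [k [ak -> ->]] [l [al -> ->]].
    exists (cscale d k + l); rewrite !cevalD !cevalZ; split=> //.
    exact/admissibleD/al/admissibleZ.
  - move=> u v u' v' [k [ak -> ->]] [l [al -> ->]].
    exists (cmul b k l); split; first exact: admissibleM.
      rewrite (cevalM (okt := true) (okj := true)) //.
      - by move=> _; apply: thetamx_sqr.
      - by move=> _; apply: taumx_sqr.
      by move=> _ _; apply: taumx_thetamx.
    by rewrite (cevalM tt jj jt ak al).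
  by move=> x; have [ax _ ex] := cP x; exists (c x).
have fE : pi f = subst (fun x => pi (gX F x.1 x.2)) f.
  apply: (nonunital_morph_subst (a := fun x => pi (gX F x.1 x.2))) => //.
  exact: scalerAr.
case: relf => d [_ Md rd]; apply/nJf/pi_ker; rewrite fE rd.
(* A zero matrix value forces [d = 0], hence [pi f = 0], although [f] is not in [J]. *)
have /ceval_mx_eq0 -> : ceval (thetamx b) (taumx F) d = 0.
  by rewrite -Md; apply: idf => x; case: (cP x).
exact: ceval0.
Qed.

End MaximalQuotient.

Theorem theorem26 (F : finFieldType) (q : nat) (b : F)
    (char2 : 2%N \in [pchar F]) (cardF : #|F| = q)
    (hb : forall x : F, b <> x ^+ 2 + x) (f : freealg F 'Z_2) :
  graded_identity (Dtilde b) f <->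
  T_ideal_gen
    (fun s => s = gen1 F q \/ s = gen2 F q \/ s = gen3 F q \/ s = gen4 F q) f.
Proof.
split=> [idf I TI Igen|Tf]; last first.
  apply: Tf; first exact: Dtilde_identities_T_ideal.
  move=> s [->|[->|[->|->]]].
  - exact: gen1_identity.
  - exact: gen2_identity.
  - exact: gen3_identity.
  exact: gen4_identity.
apply: contrapT => nIf.
have [J [idJ IJ nJf maxJ]] := maximal_ideal_avoiding (T_ideal_two_sided TI) nIf.
have nJ1 : ~ J 1 by move=> J1; apply: nJf; rewrite -[f]mulr1; apply: two_sidedMl.
have [R [pi [pi_surj pi_ker]]] :=
  quotient_algebra (@malg_scaleAr F 'Z_2) idJ nJ1.
have I1 : I (gen1 F q) by apply: Igen; left.
have I2 : I (gen2 F q) by apply: Igen; right; left.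
have I3 : I (gen3 F q) by apply: Igen; right; right; left.
exact: (not_graded_identity char2 cardF hb TI IJ nJf maxJ I1 I2 I3
  pi_surj pi_ker (proj1 idf) idf).
Qed.
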